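(* Let $q$ be a nonzero real number with $|q|$ small enough that the series below converge (in particular $|z_2(q)|<1$). Let $c_n$ be the coefficient of $q^n$ in \[ f(q)=\sum_{n=0}^\infty \frac{g_n}{2n+1}q^n,\qquad\text{where}\qquad \eta^4(q)\eta^4(q^2)\left(1-\frac{128}{64+\eta^{24}(q)\eta^{-24}(q^2)}\right)=q^{1/2}\sum_{n=0}^\infty g_nq^n \] (so $f(q)=1-44q+1126q^2-27096q^3+\cdots$). Then \[ F_2\!\left(\tfrac12,q\right)=16\,F_2(0,q)\,\sqrt q\sum_{n=0}^\infty c_n\frac{q^n}{(2n+1)^2}, \] and \[ G_2\!\left(\tfrac12,q\right)=\frac{16\sqrt q}{\pi}\left(\sum_{n=0}^\infty c_n\frac{q^n}{(2n+1)^2}-\frac{\ln|q|}{2}\sum_{n=0}^\infty c_n\frac{q^n}{2n+1}\right). \]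
   Context: $\eta(q)=q^{1/24}\prod_{n\ge1}(1-q^n)$ is the Dedekind eta function (so $\eta^{24}(q)\eta^{-24}(q^2)=q^{-1}\prod_{n\ge1}(1-q^n)^{24}(1-q^{2n})^{-24}$ and $\eta^4(q)\eta^4(q^2)=q^{1/2}\prod_{n\ge1}(1-q^n)^4(1-q^{2n})^4$). Put $x_2(q)=\dfrac{64}{64+\eta^{24}(q)\eta^{-24}(q^2)}$ and $z_2(q)=4x_2(q)(1-x_2(q))$. With $(a)_n$ the rising factorial and $z_2=z_2(q)$, for $x\in\{0,\frac12\}$ \[ F_2(x,q)=\sum_{n=0}^\infty\frac{(\frac12+x)_n(\frac14+x)_n(\frac34+x)_n}{(1+x)_n^3}z_2^{n+x},\quad G_2(x,q)=\sum_{n=0}^\infty\frac{(\frac12+x)_n(\frac14+x)_n(\frac34+x)_n}{(1+x)_n^3}\big[a_2+b_2(n+x)\big]z_2^{n+x}, \] where \[ b_2(q)=-\frac{\ln|q|}{\pi}\,\frac{q\,\frac{d z_2}{dq}}{z_2\,F_2(0,q)},\qquad a_2(q)=\frac{1}{\pi F_2(0,q)}\left(1+\ln|q|\,\frac{q\,\frac{d}{dq}F_2(0,q)}{F_2(0,q)}\right) \] (these are the functions for which $G_2(0,q)=1/\pi$). Here $z^{n+x}=z^nz^x$, and for negative real $w$, $w^{1/2}$ and $\sqrt w$ mean $i\sqrt{|w|}$. *)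

(* Defs.v *)
(* Stdlib reals, with Coquelicot for limits, series, derivatives and complex
   numbers. *)
From Stdlib Require Import Reals Lra.
From Coquelicot Require Import Coquelicot.
Open Scope R_scope.

(* Sum of a convergent complex series and derivative of a complex function of
   a real variable, taken componentwise. *)
Definition CSeries (u : nat -> C) : C :=
  (Series (fun n => Re (u n)), Series (fun n => Im (u n))).

Definition CDerive (f : R -> C) (t : R) : C :=
  (Derive (fun s => Re (f s)) t, Derive (fun s => Im (f s)) t).

Definition Csqrt (w : R) : C :=
  if Rlt_dec w 0 then Cmult Ci (RtoC (sqrt (Rabs w))) else RtoC (sqrt w).

(* Principal power of a nonzero real w: for w < 0 it is |w|^x e^(i pi x).
   The value at w = 0 is meaningless. *)
Definition Crpow (w x : R) : C :=
  if Rlt_dec w 0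
  then (Rpower (Rabs w) x * cos (PI * x), Rpower (Rabs w) x * sin (PI * x))
  else RtoC (Rpower w x).

Lemma Crpow_0 (w : R) : w <> 0 -> Crpow w 0 = RtoC 1.
Proof.
  intros Hw. unfold Crpow.
  destruct (Rlt_dec w 0) as [H|H].
  - rewrite Rpower_O by (apply Rabs_pos_lt; exact Hw).
    rewrite Rmult_0_r, cos_0, sin_0. unfold RtoC. f_equal; ring.
  - rewrite Rpower_O by lra. reflexivity.
Qed.

Lemma Crpow_half (w : R) : w <> 0 -> Crpow w (1 / 2) = Csqrt w.
Proof.
  intros Hw. unfold Crpow, Csqrt.
  replace (1 / 2) with (/ 2) by field.
  destruct (Rlt_dec w 0) as [H|H].
  - rewrite Rpower_sqrt by (apply Rabs_pos_lt; exact Hw).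
    change (PI * / 2) with (PI / 2). rewrite cos_PI2, sin_PI2.
    unfold Ci, RtoC, Cmult; simpl. f_equal; ring.
  - rewrite Rpower_sqrt by lra. reflexivity.
Qed.

Fixpoint rising (a : R) (n : nat) : R :=
  match n with
  | O => 1
  | S m => rising a m * (a + INR m)
  end.

(* The infinite product of (1 - q^n) over n >= 1. *)
Definition qprod (q : R) : R :=
  real (Lim_seq (prod_f_R0 (fun n => 1 - q ^ S n))).

(* eta^24(q) eta^(-24)(q^2): the factors q^(1/24) contribute q^(-1). *)
Definition eta_quot (q : R) : R := / q * qprod q ^ 24 / qprod (q ^ 2) ^ 24.

(* eta^4(q) eta^4(q^2): the factors q^(1/24) contribute q^(1/2). *)
Definition eta_prod (q : R) : C :=
  Cmult (Csqrt q) (RtoC (qprod q ^ 4 * qprod (q ^ 2) ^ 4)).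

Definition x2 (q : R) : R := 64 / (64 + eta_quot q).

Definition z2 (q : R) : R := 4 * x2 q * (1 - x2 q).

Definition hcoef (x : R) (n : nat) : R :=
  rising (1 / 2 + x) n * rising (1 / 4 + x) n * rising (3 / 4 + x) n
  / rising (1 + x) n ^ 3.

(* z2(q)^(n+x), read as z2(q)^n z2(q)^x. *)
Definition z2pow (x q : R) (n : nat) : C :=
  Cmult (RtoC (z2 q ^ n)) (Crpow (z2 q) x).

Definition F2 (x q : R) : C :=
  CSeries (fun n => Cmult (RtoC (hcoef x n)) (z2pow x q n)).

Definition b2 (q : R) : C :=
  (- (RtoC (ln (Rabs q) / PI)) * (RtoC (q * Derive z2 q) / (z2 q * F2 0 q)))%C.

Definition a2 (q : R) : C :=
  (1 / (PI * F2 0 q)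
   * (1 + ln (Rabs q) * (q * CDerive (F2 0) q / F2 0 q)))%C.

Definition G2 (x q : R) : C :=
  CSeries (fun n =>
    (hcoef x n * (a2 q + b2 q * RtoC (INR n + x)%R) * z2pow x q n)%C).

(* g is the coefficient sequence in
   eta^4(q) eta^4(q^2) (1 - 128 / (64 + eta^24(q) eta^(-24)(q^2)))
     = q^(1/2) * sum_n g_n q^n,
   an identity near q = 0; it determines g uniquely. *)
Definition g_expansion (g : nat -> R) : Prop :=
  locally' 0 (fun q =>
    ex_pseries g q /\
    (eta_prod q * RtoC (1 - 128 / (64 + eta_quot q))%R
     = Csqrt q * RtoC (PSeries g q))%C).

(* The coefficient of q^n in f(q) = sum_n g_n / (2n+1) q^n. *)
Definition coef_f (g : nat -> R) (n : nat) : R := g n / (2 * INR n + 1).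

(* The size condition on q: the expansions in powers of z2 converge at every
   point between 0 and q, and the power series with coefficients c converges.
   Imposing |z2| < 1 at q alone would not be enough: z2 takes values in (-1, 1)
   again farther away from 0 (z2(1/50) is about 0.88), on another branch, where
   the hypergeometric series no longer satisfy the identities. *)
Definition small_nome (c : nat -> R) (q : R) : Prop :=
  Rabs q < 1 /\
  (forall t, 0 < t <= 1 ->
     64 + eta_quot (t * q) <> 0 /\ Rabs (z2 (t * q)) < 1) /\
  Rbar_lt (Rabs q) (CV_radius c).

(* Main.v *)
Require Import Defs.
From Stdlib Require Import Reals Lra Lia.
From Coquelicot Require Import Coquelicot.
Open Scope R_scope.

(** Write [theta = q d/dq], [alpha = phi(q)^2] and [beta = phi(-q)^2] with
    Ramanujan's theta functions, which Gauss's identities express as eta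
    quotients. Then [A = 2 alpha^2 - beta^2] satisfies
    [A^2 = (64 + eta^24(q) eta^(-24)(q^2)) q psi(q)^8], so that [z_2] is rational
    in [alpha] and [beta]. The theta functions obey
    [2 alpha(q^2) = alpha + beta] and [beta(q^2)^2 = alpha beta]; since any
    quantity invariant under [q -> q^2] equals its limit at 0, these doubling
    formulas alone force the differential equations
    [theta ln(alpha/beta) = D = (alpha^2 - beta^2)/2] and
    [2 theta M = M^2 - D^2] for [M = theta ln(alpha beta)].

    From these one computes that the third order hypergeometric operator, applied
    to [A Phi], is a multiple of [theta^3 Phi]. Applied to [F_2(0,q) = A Phi]
    this gives [theta^3 Phi = 0], hence [F_2(0,q) = A]; applied to
    [F_2(1/2,q) = A Phi] it gives [theta^3 Phi = 2 sum_n g_n q^(n+1/2)], which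
    integrates to the first identity. The second is its Euler derivative. *)

(** Why division by A produces theta^3: in the nome, the homogeneous equation of order three has the
    solutions A, A ln q and A ln^2 q. The series of F_2(1/2,q) solves it only up to the term x^3
    z^x, x = 1/2, left over by n = 0; this defect is the source of the eta product whose
    coefficients are g_n. For q < 0 the powers q^(1/2) and z_2^(1/2) are imaginary. They are split
    off at once, so that all functions integrated are real and regular at 0, and theta becomes theta
    + x. As theta f vanishes at 0 for every differentiable f, one value at 0 starts the whole chain
    of three integrations; for x = 1/2 it is 16, the value of z_2^(1/2) / q^(1/2) at 0. The equation
    can be solved for its top derivative only where 1 - z_2 does not vanish, which is why |z_2| < 1
    is used along the whole segment from 0 to q. The second identity rests on G_2(x,q) = (1/pi) (1 -
    ln|q| theta) (F_2(x,q) / F_2(0,q)), which is what the definitions of a_2 and b_2 amount to. *)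

(** * Euler products and the theta functions built from them *)

Fixpoint qfin (q : R) (n : nat) : R :=
  match n with
  | O => 1
  | S m => qfin q m * (1 - q ^ S m)
  end.

(** [prod_f_R0] at [n] already has [n + 1] factors, whereas [qfin] starts from the empty product,
    the convenient base for the inductions below. *)
Lemma prod_f_R0_qfin (q : R) (n : nat) :
  prod_f_R0 (fun k => 1 - q ^ S k) n = qfin q (S n).
Proof.
  induction n as [|n IH].
  - simpl; ring.
  - change (prod_f_R0 (fun k => 1 - q ^ S k) n * (1 - q ^ S (S n)) = qfin q (S (S n))).
    rewrite IH; reflexivity.
Qed.

Lemma pow_abs_le (q : R) (n : nat) : Rabs q < 1 -> Rabs (q ^ S n) <= Rabs q.
Proof.
  intros Hq. rewrite <- RPow_abs. simpl.
  assert (0 <= Rabs q) by apply Rabs_pos.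
  assert (Rabs q ^ n <= 1) by (rewrite <- (pow1 n); apply pow_incr; lra).
  nra.
Qed.

Lemma one_minus_pow_pos (q : R) (n : nat) : Rabs q < 1 -> 0 < 1 - q ^ S n.
Proof.
  intros Hq. generalize (pow_abs_le q n Hq). intros H.
  generalize (Rle_abs (q ^ S n)). lra.
Qed.

Lemma one_plus_pow_pos (q : R) (n : nat) : Rabs q < 1 -> 0 < 1 + q ^ S n.
Proof.
  intros Hq. generalize (pow_abs_le q n Hq). intros H.
  generalize (Rle_abs (- q ^ S n)). rewrite Rabs_Ropp. lra.
Qed.

Lemma qfin_pos (q : R) (n : nat) : Rabs q < 1 -> 0 < qfin q n.
Proof.
  intros Hq. induction n as [|n IH].
  - simpl; lra.
  - apply Rmult_lt_0_compat; [exact IH | now apply one_minus_pow_pos].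
Qed.

Lemma Rabs_sqr_lt_1 (q : R) : Rabs q < 1 -> Rabs (q ^ 2) < 1.
Proof.
  intros Hq. eapply Rle_lt_trans; [apply (pow_abs_le q 1 Hq) | exact Hq].
Qed.

(** Both sides come from ln y <= y - 1, taken at 1 - u and at its inverse. *)
Lemma ln_one_minus_bound (u r : R) :
  Rabs u <= r -> r < 1 -> Rabs (ln (1 - u)) <= Rabs u * / (1 - r).
Proof.
  intros Hu Hr.
  assert (Hu1 : u <= Rabs u) by apply Rle_abs.
  assert (Hu2 : - u <= Rabs u) by (rewrite <- Rabs_Ropp; apply Rle_abs).
  assert (H0 : 0 <= Rabs u) by apply Rabs_pos.
  assert (Hd : 0 < 1 - u) by lra.
  assert (Hln : forall y, 0 < y -> ln y <= y - 1).
  { intros y Hy. generalize (exp_ineq1_le (ln y)). rewrite exp_ln by exact Hy. lra. }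
  assert (Hi : 1 <= / (1 - r)).
  { rewrite <- Rinv_1. apply Rinv_le_contravar; lra. }
  assert (U : ln (1 - u) <= - u) by (generalize (Hln _ Hd); lra).
  assert (L : - (u * / (1 - u)) <= ln (1 - u)).
  { generalize (Hln (/ (1 - u)) (Rinv_0_lt_compat _ Hd)). rewrite ln_Rinv by exact Hd.
    intros H. replace (u * / (1 - u)) with (/ (1 - u) - 1) by (field; lra). lra. }
  assert (B : Rabs (u * / (1 - u)) <= Rabs u * / (1 - r)).
  { rewrite Rabs_mult, (Rabs_pos_eq (/ (1 - u))) by (left; now apply Rinv_0_lt_compat).
    apply Rmult_le_compat_l; [exact H0 |]. apply Rinv_le_contravar; lra. }
  generalize (Rle_abs (u * / (1 - u))). intros B'.
  apply Rabs_le. split; nra.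
Qed.

(** Passing to logarithms exhibits the infinite product as an exponential. This gives convergence
    and also positivity, so that eta quotients may be formed freely. *)
Lemma ex_series_ln_one_minus_pow (q : R) :
  Rabs q < 1 -> ex_series (fun n => ln (1 - q ^ S n)).
Proof.
  intros Hq. apply ex_series_Rabs.
  apply (ex_series_le (K := R_AbsRing) (V := R_CompleteNormedModule)
           _ (fun n => Rabs q ^ S n * / (1 - Rabs q))).
  - intros n. change (Rabs (Rabs (ln (1 - q ^ S n))) <= Rabs q ^ S n * / (1 - Rabs q)).
    rewrite Rabs_Rabsolu, RPow_abs. apply ln_one_minus_bound; [now apply pow_abs_le | exact Hq].
  - apply (ex_series_ext (fun n => (Rabs q * / (1 - Rabs q)) * Rabs q ^ n)).
    + intros n. simpl. unfold mult; simpl. ring.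
    + apply (ex_series_scal_l (V := R_NormedModule)). apply ex_series_geom. now rewrite Rabs_Rabsolu.
Qed.

Lemma qfin_exp (q : R) (n : nat) :
  Rabs q < 1 -> qfin q (S n) = exp (sum_f_R0 (fun k => ln (1 - q ^ S k)) n).
Proof.
  intros Hq. induction n as [|n IH].
  - change (qfin q 1 = exp (ln (1 - q ^ 1))).
    rewrite exp_ln by now apply one_minus_pow_pos. simpl; ring.
  - rewrite tech5, exp_plus, <- IH, exp_ln by now apply one_minus_pow_pos.
    reflexivity.
Qed.

Lemma qfin_lim_exp (q : R) :
  Rabs q < 1 ->
  is_lim_seq (qfin q) (exp (Series (fun n => ln (1 - q ^ S n)))).
Proof.
  intros Hq. apply is_lim_seq_incr_1.
  apply (is_lim_seq_ext (fun n => exp (sum_n (fun k => ln (1 - q ^ S k)) n))).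
  - intros n. rewrite sum_n_Reals. symmetry. now apply qfin_exp.
  - apply is_lim_seq_continuous; [apply derivable_continuous_pt, derivable_pt_exp |].
    apply (Series_correct _ (ex_series_ln_one_minus_pow q Hq)).
Qed.

Lemma qprod_exp (q : R) :
  Rabs q < 1 -> qprod q = exp (Series (fun n => ln (1 - q ^ S n))).
Proof.
  intros Hq. unfold qprod.
  rewrite (Lim_seq_ext _ (fun n => qfin q (S n))) by (intros n; apply prod_f_R0_qfin).
  rewrite (is_lim_seq_unique _ (Finite (exp (Series (fun n => ln (1 - q ^ S n)))))).
  - reflexivity.
  - apply (is_lim_seq_incr_1 (qfin q)). now apply qfin_lim_exp.
Qed.

Lemma qfin_lim (q : R) : Rabs q < 1 -> is_lim_seq (qfin q) (qprod q).
Proof. intros Hq. rewrite qprod_exp by exact Hq. now apply qfin_lim_exp. Qed.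

Lemma qprod_pos (q : R) : Rabs q < 1 -> 0 < qprod q.
Proof. intros Hq. rewrite qprod_exp by exact Hq. apply exp_pos. Qed.

Lemma filterlim_affine (k c : nat) :
  (0 < k)%nat -> filterlim (fun n => (k * n + c)%nat) eventually eventually.
Proof.
  intros Hk P [N HN]. exists N. intros n Hn. apply HN. nia.
Qed.

Lemma qfin_double_lim (q : R) :
  Rabs q < 1 -> is_lim_seq (fun n => qfin q (2 * n)) (qprod q).
Proof.
  intros Hq. apply (is_lim_seq_ext (fun n => qfin q (2 * n + 0))).
  - intros n. f_equal. lia.
  - apply (is_lim_seq_subseq (qfin q) _ (fun n => (2 * n + 0)%nat)).
    + apply filterlim_affine. lia.
    + now apply qfin_lim.
Qed.

Lemma qfin_even (q : R) (n : nat) :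
  qfin q (2 * S n) = qfin q (2 * n) * (1 - q * (q ^ n * q ^ n)) * (1 - q ^ 2 * (q ^ n * q ^ n)).
Proof.
  replace (2 * S n)%nat with (S (S (2 * n))) by lia.
  change (qfin q (2 * n) * (1 - q ^ S (2 * n)) * (1 - q ^ S (S (2 * n))) =
    qfin q (2 * n) * (1 - q * (q ^ n * q ^ n)) * (1 - q ^ 2 * (q ^ n * q ^ n))).
  replace (q ^ S (2 * n)) with (q * (q ^ n * q ^ n)).
  2:{ replace (S (2 * n)) with (1 + (n + n))%nat by lia. rewrite !pow_add. ring. }
  replace (q ^ S (S (2 * n))) with (q ^ 2 * (q ^ n * q ^ n)).
  2:{ replace (S (S (2 * n))) with (2 + (n + n))%nat by lia. rewrite !pow_add. ring. }
  reflexivity.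
Qed.

Lemma qfin_S (q : R) (n : nat) : qfin q (S n) = qfin q n * (1 - q * q ^ n).
Proof. reflexivity. Qed.

(** For odd k the factors 1 - q^k and 1 + q^k combine to 1 - q^(2k); for even k they coincide and
    fill the square on the right. The product in q^4 supplies the missing even factors of
    [qfin (q ^ 2) (2 * n)]. The lengths n and 2n make this exact before any limit. *)
Lemma qfin_opp (q : R) (n : nat) :
  qfin q (2 * n) * qfin (- q) (2 * n) * qfin ((q ^ 2) ^ 2) n
  = qfin (q ^ 2) n ^ 2 * qfin (q ^ 2) (2 * n).
Proof.
  induction n as [|n IH].
  - simpl; ring.
  - rewrite !qfin_even, !qfin_S.
    assert (E : (- q) ^ n * (- q) ^ n = q ^ n * q ^ n).
    { rewrite <- !Rpow_mult_distr. f_equal. ring. }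
    rewrite E, <- !pow_mult, !(pow_mult q 2 n).
    replace (q ^ (2 * 2 * n)) with (q ^ n * q ^ n * (q ^ n * q ^ n))
      by (rewrite <- !pow_add; f_equal; lia).
    replace ((q ^ 2) ^ n) with (q ^ n * q ^ n)
      by (rewrite <- pow_mult, <- !pow_add; f_equal; lia).
    replace (q ^ (2 * 2)) with (q ^ 4) by reflexivity.
    replace ((q^2)^2) with (q^4) in IH by ring.
    transitivity ((qfin q (2 * n) * qfin (- q) (2 * n) * qfin (q ^ 4) n)
      * ((1 - q * (q ^ n * q ^ n)) * (1 - q ^ 2 * (q ^ n * q ^ n))
         * ((1 + q * (q ^ n * q ^ n)) * (1 - q ^ 2 * (q ^ n * q ^ n)))
         * (1 - q ^ 4 * (q ^ n * q ^ n * (q ^ n * q ^ n))))).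
    + ring.
    + rewrite IH. ring.
Qed.

Lemma lim_seq_eq (u v : nat -> R) (a b : R) :
  is_lim_seq u a -> is_lim_seq v b -> (forall n, u n = v n) -> a = b.
Proof.
  intros Hu Hv E. apply (is_lim_seq_ext _ _ _ E) in Hu.
  apply is_lim_seq_unique in Hu. apply is_lim_seq_unique in Hv. congruence.
Qed.

Lemma qprod_opp (q : R) :
  Rabs q < 1 ->
  qprod q * qprod (- q) * qprod ((q ^ 2) ^ 2) = qprod (q ^ 2) ^ 3.
Proof.
  intros Hq.
  assert (Hm : Rabs (- q) < 1) by now rewrite Rabs_Ropp.
  assert (H2 := Rabs_sqr_lt_1 q Hq).
  assert (H4 := Rabs_sqr_lt_1 _ H2).
  assert (L : is_lim_seq (fun n => qfin q (2 * n) * qfin (- q) (2 * n) * qfin ((q ^ 2) ^ 2) n)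
     (qprod q * qprod (- q) * qprod ((q ^ 2) ^ 2))).
  { apply is_lim_seq_mult'; [apply is_lim_seq_mult' |];
      auto using qfin_lim, qfin_double_lim. }
  assert (R0 : is_lim_seq (fun n => qfin (q ^ 2) n * qfin (q ^ 2) n * qfin (q ^ 2) (2 * n))
     (qprod (q ^ 2) * qprod (q ^ 2) * qprod (q ^ 2))).
  { apply is_lim_seq_mult'; [apply is_lim_seq_mult' |];
      auto using qfin_lim, qfin_double_lim. }
  replace (qprod (q ^ 2) ^ 3) with (qprod (q ^ 2) * qprod (q ^ 2) * qprod (q ^ 2)) by ring.
  apply (lim_seq_eq _ _ _ _ L R0). intros n. rewrite qfin_opp. ring.
Qed.

(* [phim q] is phi(-q) in Ramanujan's notation, by Gauss's product. *)
Definition phim (q : R) : R := qprod q ^ 2 / qprod (q ^ 2).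
Definition phi (q : R) : R := phim (- q).
(** Ramanujan's psi, the generating function of the triangular numbers, again by Gauss's product. *)
Definition psi (q : R) : R := qprod (q ^ 2) ^ 2 / qprod q.

Lemma phim_pos (q : R) : Rabs q < 1 -> 0 < phim q.
Proof.
  intros Hq. apply Rdiv_lt_0_compat.
  - apply pow_lt, qprod_pos, Hq.
  - apply qprod_pos, Rabs_sqr_lt_1, Hq.
Qed.

Lemma phi_pos (q : R) : Rabs q < 1 -> 0 < phi q.
Proof. intros Hq. apply phim_pos. now rewrite Rabs_Ropp. Qed.

Lemma psi_pos (q : R) : Rabs q < 1 -> 0 < psi q.
Proof.
  intros Hq. apply Rdiv_lt_0_compat.
  - apply pow_lt, qprod_pos, Rabs_sqr_lt_1, Hq.
  - apply qprod_pos, Hq.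
Qed.

Lemma qprod_neg (q : R) :
  Rabs q < 1 ->
  qprod (- q) = qprod (q ^ 2) ^ 3 / (qprod q * qprod ((q ^ 2) ^ 2)).
Proof.
  intros Hq. rewrite <- (qprod_opp q Hq).
  assert (H1 := qprod_pos q Hq).
  assert (H2 := qprod_pos _ (Rabs_sqr_lt_1 _ (Rabs_sqr_lt_1 _ Hq))).
  field. split; lra.
Qed.

Lemma neg_sqr (q : R) : (- q) ^ 2 = q ^ 2.
Proof. ring. Qed.

Lemma phi_mul_phim (q : R) : Rabs q < 1 -> phi q * phim q = phim (q ^ 2) ^ 2.
Proof.
  intros Hq. unfold phi, phim. rewrite neg_sqr, qprod_neg by exact Hq.
  assert (H1 := qprod_pos q Hq).
  assert (H2 := qprod_pos _ (Rabs_sqr_lt_1 _ Hq)).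
  assert (H3 := qprod_pos _ (Rabs_sqr_lt_1 _ (Rabs_sqr_lt_1 _ Hq))).
  field. repeat split; lra.
Qed.

Lemma phi_mul_psi (q : R) : Rabs q < 1 -> phi q * psi (q ^ 2) = psi q ^ 2.
Proof.
  intros Hq. unfold phi, phim, psi. rewrite neg_sqr, qprod_neg by exact Hq.
  assert (H1 := qprod_pos q Hq).
  assert (H2 := qprod_pos _ (Rabs_sqr_lt_1 _ Hq)).
  assert (H3 := qprod_pos _ (Rabs_sqr_lt_1 _ (Rabs_sqr_lt_1 _ Hq))).
  field. repeat split; lra.
Qed.

(** * Gauss's product formulas for theta series *)

Lemma bounded_of_lim (u : nat -> R) (l : R) :
  is_lim_seq u l -> exists K, 0 < K /\ forall n, Rabs (u n) <= K.
Proof.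
  intros Hu. destruct (maj_by_pos u) as [K [HK H]].
  - exists l. now apply is_lim_seq_Reals.
  - exists K. auto.
Qed.

Lemma sum_pow_tail_bound (r : nat -> R) (K y : R) (N : nat) :
  (forall s, Rabs (r s) <= K) -> Rabs y < 1 ->
  Rabs (sum_f_R0 (fun s => r s * y ^ s) N - r O) <= K * (Rabs y / (1 - Rabs y)).
Proof.
  intros Hr Hy.
  assert (H0 := Rabs_pos y).
  assert (HK : 0 <= K) by (eapply Rle_trans; [apply Rabs_pos | apply (Hr O)]).
  assert (H : Rabs (sum_f_R0 (fun s => r s * y ^ s) N - r O)
      <= K * (Rabs y * (1 - Rabs y ^ N) / (1 - Rabs y))).
  { induction N as [|N IH].
    - simpl. replace (r O * 1 - r O) with 0 by ring. rewrite Rabs_R0. right. field. lra.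
    - rewrite tech5.
      replace (sum_f_R0 (fun s => r s * y ^ s) N + r (S N) * y ^ S N - r O)
        with ((sum_f_R0 (fun s => r s * y ^ s) N - r O) + r (S N) * y ^ S N) by ring.
      eapply Rle_trans; [apply Rabs_triang |].
      assert (Rabs (r (S N) * y ^ S N) <= K * Rabs y ^ S N).
      { rewrite Rabs_mult, <- RPow_abs. apply Rmult_le_compat_r; [apply pow_le, H0 | apply Hr]. }
      replace (K * (Rabs y * (1 - Rabs y ^ S N) / (1 - Rabs y)))
        with (K * (Rabs y * (1 - Rabs y ^ N) / (1 - Rabs y)) + K * Rabs y ^ S N)
        by (simpl; field; lra).
      lra. }
  eapply Rle_trans; [exact H |].
  apply Rmult_le_compat_l; [exact HK |].
  unfold Rdiv. apply Rmult_le_compat_r; [left; apply Rinv_0_lt_compat; lra |].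
  generalize (pow_le (Rabs y) N H0). nra.
Qed.

(** The geometric bound on the tail does not depend on the number of terms, so [N n] may grow while
    [y n] tends to 0. *)
Lemma sum_pow_tail_lim (r y : nat -> R) (N : nat -> nat) (K : R) :
  (forall s, Rabs (r s) <= K) -> (forall n, Rabs (y n) < 1) -> is_lim_seq y 0 ->
  is_lim_seq (fun n => sum_f_R0 (fun s => r s * y n ^ s) (N n)) (r O).
Proof.
  intros Hr Hy Ly.
  assert (L : is_lim_seq (fun n => sum_f_R0 (fun s => r s * y n ^ s) (N n) - r O) 0).
  { apply is_lim_seq_abs_0.
    apply (is_lim_seq_le_le (fun _ => 0) _ (fun n => K * (Rabs (y n) / (1 - Rabs (y n))))).
    - intros n. split; [apply Rabs_pos | now apply sum_pow_tail_bound].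
    - apply is_lim_seq_const.
    - replace (Finite 0) with (Finite (K * (0 / (1 - 0)))) by (f_equal; field).
      assert (La : is_lim_seq (fun n => Rabs (y n)) 0) by now apply is_lim_seq_abs_0 in Ly.
      apply is_lim_seq_mult'; [apply is_lim_seq_const |].
      apply is_lim_seq_div'; [exact La | | lra].
      apply is_lim_seq_minus'; [apply is_lim_seq_const | exact La]. }
  apply (is_lim_seq_ext (fun n => sum_f_R0 (fun s => r s * y n ^ s) (N n) - r O + r O)).
  - intros n. ring.
  - replace (Finite (r O)) with (Finite (0 + r O)) by (f_equal; ring).
    apply is_lim_seq_plus'; [exact L | apply is_lim_seq_const].
Qed.

(** Summation step of a WZ argument: [t] and [t'] are the summand at consecutive parameters and [v]
    is the certificate, taken as 0 at index 0. *)
Lemma sum_telescope (t t' v : nat -> R) (N : nat) :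
  t' O - t O = v 1%nat ->
  (forall s, t' (S s) - t (S s) = v (S (S s)) - v (S s)) ->
  sum_f_R0 t' N = sum_f_R0 t N + v (S N).
Proof.
  intros H0 HS. induction N as [|N IH].
  - simpl. lra.
  - rewrite !tech5, IH. specialize (HS N). lra.
Qed.

Definition phim_fin (x : R) (n : nat) : R := qfin x n ^ 2 / qfin (x ^ 2) n.

(** Folding the sum of (-1)^k x^(k^2) over all integers onto k >= 0 doubles every coefficient except
    the first. *)
Definition phim_coef (k : nat) : R :=
  match k with O => 1 | S _ => 2 * (-1) ^ k end.

Lemma phim_fin_pos (x : R) (n : nat) : Rabs x < 1 -> 0 < phim_fin x n.
Proof.
  intros Hx. apply Rdiv_lt_0_compat.
  - now apply pow_lt, qfin_pos.
  - now apply qfin_pos, Rabs_sqr_lt_1.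
Qed.

Lemma phim_fin_S (x : R) (n : nat) :
  Rabs x < 1 ->
  phim_fin x (S n) = phim_fin x n * ((1 - x ^ S n) / (1 + x ^ S n)).
Proof.
  intros Hx. unfold phim_fin. simpl qfin.
  change (x * x ^ n) with (x ^ S n).
  replace (x * (x * 1) * (x * (x * 1)) ^ n) with (x ^ S n * x ^ S n)
    by (simpl; replace (x * (x * 1)) with (x * x) by ring; rewrite Rpow_mult_distr; ring).
  assert (H1 := one_minus_pow_pos x n Hx).
  assert (H2 := one_plus_pow_pos x n Hx).
  assert (H3 := qfin_pos _ n (Rabs_sqr_lt_1 x Hx)). simpl in H3.
  replace (1 - x ^ S n * x ^ S n) with ((1 - x ^ S n) * (1 + x ^ S n)) by ring.
  field. repeat split; lra.
Qed.

Lemma one_plus_pow_pos' (x : R) (n : nat) : Rabs x < 1 -> 0 < 1 + x ^ n.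
Proof.
  intros Hx. destruct n as [|n]; [simpl; lra | now apply one_plus_pow_pos].
Qed.

(* Finite form of Gauss's identity: passing from [n] to [n + 1], the differences of
   the left-hand terms telescope. As [n] grows only the term [s = 0] survives. *)
Lemma gauss_square_fin (x : R) (n : nat) :
  Rabs x < 1 ->
  sum_f_R0 (fun s => 2 * (-1) ^ s * (phim_fin x n / phim_fin x s) * (x ^ S n) ^ s
                     / (1 + x ^ s)) n
  = sum_f_R0 (fun k => phim_coef k * x ^ (k * k)) n.
Proof.
  intros Hx. induction n as [|n IH].
  - simpl. assert (H := phim_fin_pos x 0 Hx). field. lra.
  - rewrite (tech5 (fun k => phim_coef k * x ^ (k * k))), <- IH, tech5.
    assert (P1 := one_plus_pow_pos x n Hx).
    assert (PS := phim_fin_pos x (S n) Hx).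
    (* The second function is the certificate. Its value at n + 1 and the new summand s = n + 1
       share the denominator 1 + x^(n+1) and add up to the next theta term. *)
    rewrite (sum_telescope
      (fun s => 2 * (-1) ^ s * (phim_fin x n / phim_fin x s) * (x ^ S n) ^ s / (1 + x ^ s)) _
      (fun s => match s with O => 0 | S s' =>
         2 * (-1) ^ s * (phim_fin x n / phim_fin x s') * (x ^ S n) ^ s / (1 + x ^ S n) end)).
    + replace (x ^ (S n * S n)) with ((x ^ S n) ^ S n) by now rewrite pow_mult.
      replace ((x ^ S (S n)) ^ S n) with (x ^ S n * (x ^ S n) ^ S n)
        by (rewrite <- Rpow_mult_distr; f_equal; simpl; ring).
      unfold phim_coef. assert (Pn := phim_fin_pos x n Hx).
      field. repeat split; lra.
    + rewrite phim_fin_S by exact Hx. simpl pow.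
      assert (P0 := phim_fin_pos x 0 Hx). simpl in P1.
      field. repeat split; lra.
    + intros s. rewrite !phim_fin_S by exact Hx.
      assert (Ps := phim_fin_pos x s Hx).
      assert (Pn := phim_fin_pos x n Hx).
      assert (A1 := one_minus_pow_pos x s Hx).
      assert (A2 := one_plus_pow_pos x s Hx).
      replace ((x ^ S (S n)) ^ S s) with (x ^ S s * (x ^ S n) ^ S s)
        by (rewrite <- Rpow_mult_distr; f_equal; simpl; ring).
      replace ((x ^ S n) ^ S (S s)) with (x ^ S n * (x ^ S n) ^ S s) by (simpl; ring).
      replace ((-1) ^ S (S s)) with (- (-1) ^ S s) by (simpl; ring).
      set (a := x ^ S s) in *. set (b := x ^ S n) in *.
      field. repeat split; lra.
Qed.

Lemma phim_fin_lim (x : R) : Rabs x < 1 -> is_lim_seq (phim_fin x) (phim x).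
Proof.
  intros Hx. assert (H2 := Rabs_sqr_lt_1 x Hx).
  apply is_lim_seq_div'.
  - apply (is_lim_seq_ext (fun n => qfin x n * qfin x n)); [intros n; simpl; ring |].
    replace (qprod x ^ 2) with (qprod x * qprod x) by ring.
    apply is_lim_seq_mult'; now apply qfin_lim.
  - now apply qfin_lim.
  - generalize (qprod_pos _ H2). lra.
Qed.

Lemma Rinv_bounded_of_lim (u : nat -> R) (l : R) :
  (forall n, 0 < u n) -> 0 < l -> is_lim_seq u l ->
  exists K, 0 < K /\ forall n, / u n <= K.
Proof.
  intros Hu Hl Lu.
  destruct (bounded_of_lim (fun n => / u n) (/ l)) as [K [HK H]].
  - apply (is_lim_seq_inv u l Lu). intros E. injection E. lra.
  - exists K. split; [exact HK |]. intros n. eapply Rle_trans; [apply Rle_abs | apply H].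
Qed.

Lemma gauss_square (x : R) :
  Rabs x < 1 ->
  is_lim_seq (fun n => sum_f_R0 (fun k => phim_coef k * x ^ (k * k)) n) (phim x).
Proof.
  intros Hx.
  apply (is_lim_seq_ext (fun n => phim_fin x n *
     sum_f_R0 (fun s => 2 * (-1) ^ s / phim_fin x s / (1 + x ^ s) * (x ^ S n) ^ s) n)).
  - intros n. rewrite <- gauss_square_fin by exact Hx. rewrite scal_sum.
    apply sum_eq. intros s _.
    assert (H1 := phim_fin_pos x s Hx). assert (H2 := one_plus_pow_pos' x s Hx).
    field. split; lra.
  - destruct (Rinv_bounded_of_lim (phim_fin x) (phim x)) as [K [HK HB]];
      [intros n; now apply phim_fin_pos | now apply phim_pos | now apply phim_fin_lim |].
    replace (Finite (phim x)) with
      (Finite (phim x * (2 * (-1) ^ 0 / phim_fin x 0 / (1 + x ^ 0)))).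
    2:{ unfold phim_fin. simpl. f_equal. field. }
    apply is_lim_seq_mult'; [now apply phim_fin_lim |].
    assert (Hd : 0 < 1 - Rabs x) by lra.
    apply (sum_pow_tail_lim (fun s => 2 * (-1) ^ s / phim_fin x s / (1 + x ^ s))
             (fun n => x ^ S n) (fun n => n) (2 * K * / (1 - Rabs x))).
    + intros s. unfold Rdiv. rewrite !Rabs_mult, pow_1_abs.
      assert (H1 := phim_fin_pos x s Hx). assert (H2 := one_plus_pow_pos' x s Hx).
      rewrite (Rabs_pos_eq 2), !(Rabs_pos_eq (/ _)) by (try lra; left; now apply Rinv_0_lt_compat).
      apply Rmult_le_compat.
      * apply Rmult_le_pos; [lra | left; now apply Rinv_0_lt_compat].
      * left; now apply Rinv_0_lt_compat.
      * generalize (HB s). lra.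
      * apply Rinv_le_contravar; [lra |]. destruct s as [|s].
        -- simpl. generalize (Rabs_pos x). lra.
        -- generalize (pow_abs_le x s Hx) (Rle_abs (- x ^ S s)). rewrite Rabs_Ropp. lra.
    + intros n. eapply Rle_lt_trans; [now apply pow_abs_le | exact Hx].
    + apply (is_lim_seq_incr_1 (fun n => x ^ n)). now apply is_lim_seq_geom.
Qed.

Fixpoint tri (k : nat) : nat := match k with O => O | S m => (tri m + S m)%nat end.

Lemma tri_even (n : nat) : tri (2 * n) = ((2 * n + 1) * n)%nat.
Proof.
  induction n as [|n IH]; [reflexivity |].
  replace (2 * S n)%nat with (S (S (2 * n))) by lia. simpl tri. simpl in IH. rewrite IH. lia.
Qed.

Lemma tri_odd (n : nat) : tri (2 * n + 1) = ((2 * n + 1) * S n)%nat.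
Proof.
  replace (2 * n + 1)%nat with (S (2 * n)) by lia.
  change (tri (S (2 * n))) with (tri (2 * n) + S (2 * n))%nat. rewrite tri_even. lia.
Qed.

(** The lengths n and 2n make this the product of (1 - x^(2k)) / (1 - x^(2k-1)) over 1 <= k <= n. *)
Definition psi_fin (x : R) (n : nat) : R := qfin (x ^ 2) n ^ 2 / qfin x (2 * n).

Lemma psi_fin_pos (x : R) (n : nat) : Rabs x < 1 -> 0 < psi_fin x n.
Proof.
  intros Hx. apply Rdiv_lt_0_compat.
  - now apply pow_lt, qfin_pos, Rabs_sqr_lt_1.
  - now apply qfin_pos.
Qed.

Lemma one_minus_odd_pos (x : R) (n : nat) : Rabs x < 1 -> 0 < 1 - x ^ (2 * n + 1).
Proof.
  intros Hx. replace (2 * n + 1)%nat with (S (2 * n)) by lia. now apply one_minus_pow_pos.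
Qed.

Lemma psi_fin_S (x : R) (n : nat) :
  Rabs x < 1 ->
  psi_fin x (S n) = psi_fin x n * ((1 - x * x ^ (2 * n + 1)) / (1 - x ^ (2 * n + 1))).
Proof.
  intros Hx. unfold psi_fin. rewrite qfin_S, qfin_even.
  assert (E : x ^ (2 * n + 1) = x * (x ^ n * x ^ n)).
  { rewrite pow_add. replace (2 * n)%nat with (n + n)%nat by lia. rewrite pow_add. ring. }
  assert (H1 := one_minus_odd_pos x n Hx). rewrite E in *.
  replace (x ^ 2 * (x ^ 2) ^ n) with (x ^ 2 * (x ^ n * x ^ n))
    by (replace ((x ^ 2) ^ n) with (x ^ n * x ^ n);
        [ring | rewrite <- pow_mult, <- pow_add; f_equal; lia]).
  assert (H2 : 0 < 1 - x ^ 2 * (x ^ n * x ^ n)).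
  { replace (x ^ 2 * (x ^ n * x ^ n)) with (x ^ S (S (n + n))) by (simpl; rewrite pow_add; ring).
    now apply one_minus_pow_pos. }
  replace (1 - x * (x * (x ^ n * x ^ n))) with (1 - x ^ 2 * (x ^ n * x ^ n)) by ring.
  assert (H3 := qfin_pos x (2 * n) Hx).
  field. repeat split; lra.
Qed.

(** Raising the parameter from m to m + 1 telescopes and leaves x^tri(2m+1), while the last summand
    at parameter m is x^tri(2m). The theta terms therefore arrive in pairs, and the right-hand sum
    ends at an odd index. *)
Lemma gauss_triangular_fin (x : R) (n : nat) :
  Rabs x < 1 ->
  sum_f_R0 (fun s => psi_fin x (S n) / psi_fin x s * (x ^ (2 * S n + 1)) ^ s) n
  = sum_f_R0 (fun k => x ^ tri k) (2 * n + 1).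
Proof.
  intros Hx.
  assert (Step : forall m,
    sum_f_R0 (fun s => psi_fin x (S m) / psi_fin x s * (x ^ (2 * S m + 1)) ^ s) m
    = sum_f_R0 (fun s => psi_fin x m / psi_fin x s * (x ^ (2 * m + 1)) ^ s) m
      + (x ^ (2 * m + 1)) ^ S m).
  { intros m. set (Y := x ^ (2 * m + 1)).
    assert (EY : x ^ (2 * S m + 1) = x * x * Y).
    { replace (2 * S m + 1)%nat with (2 + (2 * m + 1))%nat by lia. rewrite pow_add. fold Y. ring. }
    assert (HY : 0 < 1 - Y) by now apply one_minus_odd_pos.
    rewrite EY.
    rewrite (sum_telescope
      (fun s => psi_fin x m / psi_fin x s * Y ^ s) _
      (fun s => match s with O => 0 | S s' =>
         psi_fin x m / psi_fin x s' * (1 - x ^ (2 * s' + 1)) * Y ^ s / (1 - Y) end)).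
    - fold Y. assert (H := psi_fin_pos x m Hx). field. split; lra.
    - rewrite psi_fin_S by exact Hx. fold Y. simpl.
      assert (H := psi_fin_pos x 0 Hx). field. split; lra.
    - intros s. rewrite !psi_fin_S by exact Hx. fold Y.
      set (Z := x ^ (2 * s + 1)).
      assert (HZ : 0 < 1 - Z) by now apply one_minus_odd_pos.
      assert (HZ' : 0 < 1 - x * Z).
      { replace (x * Z) with (x ^ S (2 * s + 1)) by reflexivity. now apply one_minus_pow_pos. }
      replace (x ^ (2 * S s + 1)) with (x * x * Z)
        by (unfold Z; replace (2 * S s + 1)%nat with (2 + (2 * s + 1))%nat by lia;
            rewrite (pow_add x 2 (2 * s + 1)); ring).
      replace ((x * x * Y) ^ S s) with (x * Z * Y ^ S s)
        by (unfold Z; replace (x * x) with (x ^ 2) by ring;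
            rewrite Rpow_mult_distr, <- pow_mult, tech_pow_Rmult;
            do 2 f_equal; lia).
      replace (Y ^ S (S s)) with (Y * Y ^ S s) by (simpl; ring).
      assert (H := psi_fin_pos x s Hx). assert (H' := psi_fin_pos x m Hx).
      field. repeat split; lra. }
  induction n as [|n IH].
  - rewrite Step. simpl. assert (H := psi_fin_pos x 0 Hx). field. lra.
  - rewrite Step, tech5, IH.
    replace (2 * S n + 1)%nat with (S (S (2 * n + 1))) by lia. rewrite !tech5.
    replace (S (S (2 * n + 1))) with (2 * S n + 1)%nat by lia.
    replace (S (2 * n + 1)) with (2 * S n)%nat by lia.
    rewrite tri_odd, tri_even, !pow_mult.
    assert (H := psi_fin_pos x (S n) Hx). field. lra.
Qed.

Lemma psi_fin_lim (x : R) : Rabs x < 1 -> is_lim_seq (psi_fin x) (psi x).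
Proof.
  intros Hx. assert (H2 := Rabs_sqr_lt_1 x Hx).
  apply is_lim_seq_div'.
  - apply (is_lim_seq_ext (fun n => qfin (x ^ 2) n * qfin (x ^ 2) n)); [intros n; simpl; ring |].
    replace (qprod (x ^ 2) ^ 2) with (qprod (x ^ 2) * qprod (x ^ 2)) by ring.
    apply is_lim_seq_mult'; now apply qfin_lim.
  - now apply qfin_double_lim.
  - generalize (qprod_pos _ Hx). lra.
Qed.

Lemma gauss_triangular (x : R) :
  Rabs x < 1 ->
  is_lim_seq (fun n => sum_f_R0 (fun k => x ^ tri k) (2 * n + 1)) (psi x).
Proof.
  intros Hx.
  apply (is_lim_seq_ext (fun n => psi_fin x (S n) *
     sum_f_R0 (fun s => / psi_fin x s * (x ^ (2 * S n + 1)) ^ s) n)).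
  - intros n. rewrite <- gauss_triangular_fin by exact Hx. rewrite scal_sum.
    apply sum_eq. intros s _. assert (H1 := psi_fin_pos x s Hx). field. lra.
  - destruct (Rinv_bounded_of_lim (psi_fin x) (psi x)) as [K [HK HB]];
      [intros n; now apply psi_fin_pos | now apply psi_pos | now apply psi_fin_lim |].
    replace (Finite (psi x)) with (Finite (psi x * / psi_fin x 0))
      by (unfold psi_fin; simpl; f_equal; field).
    apply is_lim_seq_mult'; [now apply (is_lim_seq_incr_1 (psi_fin x)), psi_fin_lim |].
    apply (sum_pow_tail_lim (fun s => / psi_fin x s)
             (fun n => x ^ (2 * S n + 1)) (fun n => n) K).
    + intros s. rewrite Rabs_pos_eq; [apply HB |].
      left. now apply Rinv_0_lt_compat, psi_fin_pos.
    + intros n. replace (2 * S n + 1)%nat with (S (2 * S n)) by lia.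
      eapply Rle_lt_trans; [now apply pow_abs_le | exact Hx].
    + apply (is_lim_seq_ext (fun n => x ^ (2 * n + 3))); [intros n; f_equal; lia |].
      apply (is_lim_seq_subseq (fun n => x ^ n) _ (fun n => (2 * n + 3)%nat)).
      * apply filterlim_affine. lia.
      * now apply is_lim_seq_geom.
Qed.

(** * Functions analytic on the unit disk *)

Lemma Rbar_lt_le_1 (x r : R) (l : Rbar) : Rabs x < r -> Rbar_le r l -> Rbar_lt (Rabs x) l.
Proof. intros Hx Hl. apply (Rbar_lt_le_trans (Rabs x) r l Hx Hl). Qed.

Lemma CV_radius_ge (a : nat -> R) (r : R) :
  (forall x, 0 < x < r -> ex_pseries a x) -> Rbar_le r (CV_radius a).
Proof.
  intros H. apply Rbar_not_lt_le. intros Hlt.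
  assert (H0 := CV_radius_ge_0 a).
  destruct (CV_radius a) as [c | |] eqn:E; simpl in Hlt, H0; try easy.
  set (x := (c + r) / 2).
  assert (Hx : 0 < x < r) by (unfold x; lra).
  apply (CV_disk_outside a x).
  - rewrite E, Rabs_pos_eq by lra. simpl. unfold x; lra.
  - apply (ex_series_lim_0 (fun n => a n * x ^ n)).
    destruct (H x Hx) as [l Hl]. exists l. exact (proj1 (is_pseries_R _ _ _) Hl).
Qed.

Lemma CV_radius_le_compat (a b : nat -> R) (C r : R) :
  (forall n, Rabs (a n) <= C * Rabs (b n)) ->
  Rbar_le r (CV_radius b) -> Rbar_le r (CV_radius a).
Proof.
  intros Hab Hr. apply CV_radius_ge. intros x Hx.
  apply CV_disk_correct. unfold CV_disk.
  apply (ex_series_le (K := R_AbsRing) (V := R_CompleteNormedModule)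
           _ (fun n => C * Rabs (b n * x ^ n))).
  - intros n. change (Rabs (Rabs (a n * x ^ n)) <= C * Rabs (b n * x ^ n)).
    rewrite Rabs_Rabsolu, !Rabs_mult, <- Rmult_assoc.
    apply Rmult_le_compat_r; [apply Rabs_pos | apply Hab].
  - apply (ex_series_scal_l (V := R_NormedModule)). apply CV_disk_inside.
    apply (Rbar_lt_le_1 x r); [rewrite Rabs_pos_eq; lra | exact Hr].
Qed.

Lemma CV_radius_geom : Rbar_le 1 (CV_radius (fun _ => 1)).
Proof.
  apply CV_radius_ge. intros x Hx.
  destruct (ex_series_geom x) as [l Hl]; [rewrite Rabs_pos_eq; lra |].
  exists l. apply is_pseries_R. apply (is_series_ext _ _ _ (fun n => eq_sym (Rmult_1_l (x ^ n))) Hl).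
Qed.

(** The coefficients n + 1 are those of the derivative of the geometric series. *)
Lemma CV_radius_linear (a : nat -> R) (C : R) :
  (forall n, Rabs (a n) <= C * INR (S n)) -> Rbar_le 1 (CV_radius a).
Proof.
  intros H. apply (CV_radius_le_compat a (PS_derive (fun _ => 1)) C).
  - intros n. unfold PS_derive. rewrite Rmult_1_r, (Rabs_pos_eq (INR (S n))) by apply pos_INR.
    apply H.
  - rewrite CV_radius_derive. exact CV_radius_geom.
Qed.

(** One expansion at 0, valid on all of (-1, 1). Sums, products and derivatives stay in the class by
    operations on coefficients. Quotients are treated separately, through explicit derivatives and
    continuity at 0. *)
Definition analytic (f : R -> R) : Prop :=
  exists a, Rbar_le 1 (CV_radius a) /\ forall x, Rabs x < 1 -> f x = PSeries a x.

Lemma analytic_ext (f g : R -> R) :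
  (forall x, Rabs x < 1 -> f x = g x) -> analytic f -> analytic g.
Proof.
  intros E [a [Ha Hf]]. exists a. split; [exact Ha |].
  intros x Hx. rewrite <- E by exact Hx. now apply Hf.
Qed.

Lemma analytic_plus (f g : R -> R) :
  analytic f -> analytic g -> analytic (fun x => f x + g x).
Proof.
  intros [a [Ha Hf]] [b [Hb Hg]]. exists (PS_plus a b). split.
  - apply CV_radius_ge. intros x Hx.
    apply ex_pseries_plus; apply CV_radius_inside;
      (apply (Rbar_lt_le_1 x 1); [rewrite Rabs_pos_eq; lra | assumption]).
  - intros x Hx. rewrite PSeries_plus, Hf, Hg by
      (try exact Hx; apply CV_radius_inside; now apply (Rbar_lt_le_1 x 1)).
    reflexivity.
Qed.

Lemma analytic_mult (f g : R -> R) :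
  analytic f -> analytic g -> analytic (fun x => f x * g x).
Proof.
  intros [a [Ha Hf]] [b [Hb Hg]]. exists (PS_mult a b). split.
  - apply CV_radius_ge. intros x Hx.
    apply ex_pseries_mult;
      (apply (Rbar_lt_le_1 x 1); [rewrite Rabs_pos_eq; lra | assumption]).
  - intros x Hx. rewrite PSeries_mult, Hf, Hg by
      (try exact Hx; now apply (Rbar_lt_le_1 x 1)).
    reflexivity.
Qed.

Lemma analytic_const (c : R) : analytic (fun _ => c).
Proof.
  exists (fun n => match n with O => c | _ => 0 end). split.
  - apply (CV_radius_linear _ (Rabs c)). intros [|n].
    + rewrite Rmult_1_r. apply Rle_refl.
    + rewrite Rabs_R0. apply Rmult_le_pos; [apply Rabs_pos | apply pos_INR].
  - intros x Hx. rewrite (PSeries_decr_1 _ x).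
    + rewrite (PSeries_ext _ (fun _ => 0)) by now intros [|n]. rewrite PSeries_const_0. ring.
    + apply CV_radius_inside, (Rbar_lt_le_1 x 1); [exact Hx |].
      apply (CV_radius_linear _ (Rabs c)). intros [|n].
      * rewrite Rmult_1_r. apply Rle_refl.
      * rewrite Rabs_R0. apply Rmult_le_pos; [apply Rabs_pos | apply pos_INR].
Qed.

Lemma analytic_pow (f : R -> R) (n : nat) : analytic f -> analytic (fun x => f x ^ n).
Proof.
  intros Hf. induction n as [|n IH]; [exact (analytic_const 1) |].
  exact (analytic_mult _ _ Hf IH).
Qed.

Lemma analytic_minus (f g : R -> R) :
  analytic f -> analytic g -> analytic (fun x => f x - g x).
Proof.
  intros Hf Hg. apply (analytic_ext (fun x => f x + (-1) * g x)).
  - intros x _. ring.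
  - apply analytic_plus; [exact Hf |]. apply analytic_mult; [apply analytic_const | exact Hg].
Qed.

Lemma analytic_neg (f : R -> R) : analytic f -> analytic (fun x => f (- x)).
Proof.
  intros [a [Ha Hf]]. exists (fun n => (-1) ^ n * a n). split.
  - apply (CV_radius_le_compat _ a 1); [| exact Ha].
    intros n. rewrite Rabs_mult, pow_1_abs. apply Rle_refl.
  - intros x Hx. rewrite Hf by now rewrite Rabs_Ropp.
    unfold PSeries. apply Series_ext. intros n.
    replace (- x) with (-1 * x) by ring. rewrite Rpow_mult_distr. ring.
Qed.

Lemma locally_disk (x : R) : Rabs x < 1 -> locally x (fun y => Rabs y < 1).
Proof.
  intros Hx. assert (H : 0 < 1 - Rabs x) by lra.
  exists (mkposreal _ H). intros y Hy.
  change (Rabs (y - x) < 1 - Rabs x) in Hy.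
  assert (T := Rabs_triang (y - x) x). rewrite Rplus_comm in T at 1.
  rewrite Rplus_minus in T. lra.
Qed.

Lemma analytic_derive (f : R -> R) :
  analytic f ->
  exists f', analytic f' /\ forall x, Rabs x < 1 -> is_derive f x (f' x).
Proof.
  intros [a [Ha Hf]]. exists (PSeries (PS_derive a)). split.
  - exists (PS_derive a). split; [now rewrite CV_radius_derive | reflexivity].
  - intros x Hx. apply (is_derive_ext_loc (PSeries a)).
    + generalize (locally_disk x Hx). apply filter_imp. intros y Hy. symmetry. now apply Hf.
    + apply is_derive_PSeries. now apply (Rbar_lt_le_1 x 1).
Qed.

Lemma is_derive_continuity_pt (f : R -> R) (x l : R) : is_derive f x l -> continuity_pt f x.
Proof.
  intros H. apply derivable_continuous_pt. exists l. now apply is_derive_Reals.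
Qed.

Lemma analytic_continuity_pt (f : R -> R) (x : R) :
  analytic f -> Rabs x < 1 -> continuity_pt f x.
Proof.
  intros Hf Hx. destruct (analytic_derive f Hf) as [f' [_ H]].
  now apply (is_derive_continuity_pt f x (f' x)), H.
Qed.

Lemma is_lim_eq_loc (f g : R -> R) (x a b : R) :
  is_lim f x a -> is_lim g x b -> locally' x (fun y => f y = g y) -> a = b.
Proof.
  intros Hf Hg E. apply (is_lim_ext_loc _ _ x _ E) in Hf.
  apply is_lim_unique in Hf. apply is_lim_unique in Hg. congruence.
Qed.

(* If [G f = k] near 0 with [f], [k] analytic on the unit disk, the identity
   persists on the disk of convergence of [G]. *)
Lemma PSeries_mult_identity (g : nat -> R) (f k : R -> R) :
  analytic f -> analytic k ->
  Rbar_lt 0 (CV_radius g) ->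
  locally' 0 (fun x => PSeries g x * f x = k x) ->
  forall x, Rabs x < 1 -> Rbar_lt (Rabs x) (CV_radius g) -> PSeries g x * f x = k x.
Proof.
  intros Hf Hk Hg Hloc.
  assert (Hc : continuity_pt (fun x => PSeries g x * f x - k x) 0).
  { assert (H01 : Rabs 0 < 1) by (rewrite Rabs_R0; lra).
    apply (continuity_pt_minus (fun x => PSeries g x * f x) k).
    - apply (continuity_pt_mult (PSeries g) f).
      + apply PSeries_continuity. now rewrite Rabs_R0.
      + now apply analytic_continuity_pt.
    - now apply analytic_continuity_pt. }
  (* The punctured neighbourhood says nothing at 0 itself; continuity supplies this value, and
     uniqueness of coefficients then needs a full neighbourhood. *)
  assert (H0 : PSeries g 0 * f 0 - k 0 = 0).
  { apply (is_lim_eq_loc _ (fun _ => 0) 0 _ _ (is_lim_continuity _ _ Hc) (is_lim_const 0 0)).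
    generalize Hloc. apply filter_imp. intros y Hy. rewrite Hy. ring. }
  destruct Hf as [a [Ha Hf]]. destruct Hk as [b [Hb Hk]].
  assert (Hloc0 : locally 0 (fun x => PSeries g x * f x = k x)).
  { unfold locally', within in Hloc. generalize Hloc. apply filter_imp. intros y Hy.
    destruct (Req_dec y 0) as [-> | Hy0]; [lra | now apply Hy]. }
  assert (Hrad : exists r : R, 0 < r < 1 /\ Rbar_le r (CV_radius g)).
  { destruct (CV_radius g) as [c | |]; simpl in Hg; try easy.
    - exists (Rmin c (1 / 2)). simpl. split.
      + split; [apply Rmin_glb_lt; lra |]. eapply Rle_lt_trans; [apply Rmin_r | lra].
      + apply Rmin_l.
    - exists (1 / 2). simpl. split; [lra | easy]. }
  destruct Hrad as [r [Hr Hrg]].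
  assert (Hdr : locally 0 (fun x : R => Rabs x < r)).
  { exists (mkposreal r (proj1 Hr)). intros y Hy. change (Rabs (y - 0) < r) in Hy.
    now rewrite Rminus_0_r in Hy. }
  assert (Hco : forall n, PS_mult g a n = b n).
  { intros n. apply PSeries_ext_recip.
    - apply (Rbar_lt_le_trans _ r); [apply Hr |].
      apply CV_radius_ge. intros x Hx. apply ex_pseries_mult.
      + apply (Rbar_lt_le_1 x r); [rewrite Rabs_pos_eq; lra | exact Hrg].
      + apply (Rbar_lt_le_1 x 1); [rewrite Rabs_pos_eq; lra | exact Ha].
    - apply (Rbar_lt_le_trans _ 1); [simpl; lra | exact Hb].
    - generalize (filter_and _ _ Hdr Hloc0). apply filter_imp. intros x [Hx E].
      rewrite PSeries_mult.
      + rewrite <- Hf, <- Hk by lra. exact E.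
      + now apply (Rbar_lt_le_1 x r).
      + apply (Rbar_lt_le_1 x 1); [lra | exact Ha]. }
  intros x Hx Hxg. rewrite Hf, Hk by exact Hx.
  rewrite <- (PSeries_ext _ _ x Hco). symmetry. apply PSeries_mult; [exact Hxg |].
  now apply (Rbar_lt_le_1 x 1).
Qed.

(* The coefficients of the lacunary series [sum_k c_k x^(e k)]. *)
Definition lacunary (e : nat -> nat) (c : nat -> R) (m : nat) : R :=
  sum_f_R0 (fun k => if Nat.eqb (e k) m then c k else 0) m.

Lemma sum_f_R0_extend (u : nat -> R) (n m : nat) :
  (n <= m)%nat -> (forall k, (n < k)%nat -> u k = 0) -> sum_f_R0 u m = sum_f_R0 u n.
Proof.
  intros Hnm Hu. induction Hnm as [|m Hnm IH]; [reflexivity |].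
  rewrite tech5, IH, Hu by lia. ring.
Qed.

Lemma lacunary_partial_sum (e : nat -> nat) (c : nat -> R) (x : R) (M : nat) :
  (forall k, (k <= e k)%nat) ->
  sum_f_R0 (fun m => lacunary e c m * x ^ m) M
  = sum_f_R0 (fun k => if Nat.leb (e k) M then c k * x ^ e k else 0) M.
Proof.
  intros He. induction M as [|M IH].
  - unfold lacunary. simpl. generalize (He O). destruct (e O); simpl; intros; ring.
  - rewrite tech5, IH.
    rewrite <- (sum_f_R0_extend (fun k => if Nat.leb (e k) M then c k * x ^ e k else 0) M (S M)).
    + unfold lacunary. rewrite Rmult_comm, scal_sum, <- sum_plus.
      apply sum_eq. intros k _.
      destruct (Nat.eqb_spec (e k) (S M)) as [E | E].
      * rewrite E. rewrite (proj2 (Nat.leb_gt (S M) M)) by lia.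
        rewrite (proj2 (Nat.leb_le (S M) (S M))) by lia. ring.
      * destruct (Nat.leb_spec (e k) M) as [L | L].
        -- rewrite (proj2 (Nat.leb_le (e k) (S M))) by lia. ring.
        -- rewrite (proj2 (Nat.leb_gt (e k) (S M))) by lia. ring.
    + lia.
    + intros k Hk. rewrite (proj2 (Nat.leb_gt (e k) M)); [reflexivity |].
      specialize (He k). lia.
Qed.

(** The sum over k <= N is the partial sum of degree e(N) of the power series. That series converges
    because its coefficients are at most C(n + 1) in size, so knowing the limit along the indices
    [N] identifies its sum; for [psi] the limit is known along odd indices. *)
Lemma analytic_lacunary (e : nat -> nat) (c : nat -> R) (C : R) (N : nat -> nat) (f : R -> R) :
  (forall k, (e k < e (S k))%nat) -> (forall k, Rabs (c k) <= C) ->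
  filterlim N eventually eventually ->
  (forall x, Rabs x < 1 ->
     is_lim_seq (fun n => sum_f_R0 (fun k => c k * x ^ e k) (N n)) (f x)) ->
  analytic f.
Proof.
  intros He Hc HN Hf.
  assert (Hmono : forall n k, (n < k)%nat -> (e n < e k)%nat).
  { intros n k Hk. induction Hk as [|k Hk IH]; [apply He | specialize (He k); lia]. }
  assert (Hge : forall k, (k <= e k)%nat).
  { induction k as [|k IH]; [lia | specialize (He k); lia]. }
  assert (HC : 0 <= C) by (eapply Rle_trans; [apply Rabs_pos | apply (Hc O)]).
  assert (Hrad : Rbar_le 1 (CV_radius (lacunary e c))).
  { apply (CV_radius_linear _ C). intros n. unfold lacunary.
    eapply Rle_trans; [apply Rsum_abs |].
    rewrite <- sum_cte. apply sum_Rle. intros k _.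
    destruct (Nat.eqb (e k) n); [apply Hc | rewrite Rabs_R0; exact HC]. }
  exists (lacunary e c). split; [exact Hrad |]. intros x Hx.
  assert (HP := PSeries_correct _ _ (CV_radius_inside _ x (Rbar_lt_le_1 x 1 _ Hx Hrad))).
  apply is_pseries_R in HP.
  assert (HL : is_lim_seq (sum_n (fun m => lacunary e c m * x ^ m)) (PSeries (lacunary e c) x))
    by exact HP.
  apply (is_lim_seq_subseq _ _ (fun n => e (N n))) in HL.
  - apply (lim_seq_eq _ _ _ _ (Hf x Hx) HL).
    intros n. rewrite sum_n_Reals, lacunary_partial_sum by exact Hge.
    rewrite (sum_f_R0_extend _ (N n) (e (N n))); [| apply Hge |].
    + apply sum_eq. intros k Hk.
      assert (e k <= e (N n))%nat.
      { destruct (Nat.eq_dec k (N n)) as [-> | Hne]; [lia |].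
        apply Nat.lt_le_incl, Hmono. lia. }
      now rewrite (proj2 (Nat.leb_le (e k) (e (N n)))).
    + intros k Hk. specialize (Hmono _ _ Hk).
      now rewrite (proj2 (Nat.leb_gt (e k) (e (N n)))).
  - apply (filterlim_comp _ _ _ N e eventually eventually eventually HN).
    intros P [n0 Hn0]. exists n0. intros n Hn. apply Hn0. specialize (Hge n). lia.
Qed.

Lemma analytic_phim : analytic phim.
Proof.
  apply (analytic_lacunary (fun k => (k * k)%nat) phim_coef 2 (fun n => n)).
  - intros k. nia.
  - intros [|k]; unfold phim_coef.
    + rewrite Rabs_R1; lra.
    + rewrite Rabs_mult, pow_1_abs, Rabs_pos_eq; lra.
  - apply filterlim_id.
  - exact gauss_square.
Qed.

Lemma analytic_phi : analytic phi.
Proof. apply (analytic_neg phim), analytic_phim. Qed.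

Lemma analytic_psi : analytic psi.
Proof.
  apply (analytic_lacunary tri (fun _ => 1) 1 (fun n => (2 * n + 1)%nat)).
  - intros k. simpl. lia.
  - intros _. rewrite Rabs_R1. lra.
  - apply filterlim_affine. lia.
  - intros x Hx.
    apply (is_lim_seq_ext _ _ _ (fun n => sum_eq _ _ _ (fun k _ => eq_sym (Rmult_1_l (x ^ tri k))))).
    now apply gauss_triangular.
Qed.

(** * Parity dissection of the theta series *)

Lemma pow_neg_even (x : R) (m : nat) : (- x) ^ (2 * m) = x ^ (2 * m).
Proof. now rewrite !pow_mult, neg_sqr. Qed.

Lemma pow_neg_odd (x : R) (m : nat) : (- x) ^ S (2 * m) = - x ^ S (2 * m).
Proof. simpl pow. change (m + (m + 0))%nat with (2 * m)%nat. rewrite pow_neg_even. ring. Qed.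

(** The signs cancel because j + j^2 is twice a triangular number. *)
Lemma phim_coef_sign (j : nat) : phim_coef j * (-1) ^ (j * j) = match j with O => 1 | _ => 2 end.
Proof.
  destruct j as [|j]; [simpl; ring |]. unfold phim_coef.
  rewrite Rmult_assoc, <- pow_add.
  replace (S j + S j * S j)%nat with (2 * tri (S j))%nat.
  - rewrite pow_1_even. ring.
  - induction j as [|j IH]; [reflexivity | simpl in *; lia].
Qed.

Lemma phim_coef_even (j : nat) : phim_coef (2 * j) = match j with O => 1 | _ => 2 end.
Proof.
  destruct j as [|j]; [reflexivity |].
  replace (phim_coef (2 * S j)) with (2 * (-1) ^ (2 * S j)) by
    (replace (2 * S j)%nat with (S (S (2 * j))) by lia; reflexivity).
  rewrite pow_1_even. ring.
Qed.

Lemma phim_coef_odd (j : nat) : phim_coef (2 * j + 1) = -2.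
Proof.
  replace (2 * j + 1)%nat with (S (2 * j)) by lia. unfold phim_coef.
  rewrite pow_1_odd. ring.
Qed.

(** Odd squares cancel, and (2j)^2 = 4 j^2 turns the even ones into the series of phi(x^4). *)
Lemma phi_plus_phim_fin (x : R) (n : nat) :
  sum_f_R0 (fun k => phim_coef k * (- x) ^ (k * k)) (2 * n + 1)
  + sum_f_R0 (fun k => phim_coef k * x ^ (k * k)) (2 * n + 1)
  = 2 * sum_f_R0 (fun k => phim_coef k * (- ((x ^ 2) ^ 2)) ^ (k * k)) n.
Proof.
  induction n as [|n IH].
  - simpl. ring.
  - replace (2 * S n + 1)%nat with (S (S (2 * n + 1))) by lia. rewrite !tech5.
    replace (S (S (2 * n + 1))) with (2 * S n + 1)%nat by lia.
    replace (S (2 * n + 1)) with (2 * S n)%nat by lia.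
    rewrite phim_coef_even, phim_coef_odd.
    replace (2 * S n * (2 * S n))%nat with (2 * (2 * (S n * S n)))%nat by lia.
    replace ((2 * S n + 1) * (2 * S n + 1))%nat
      with (S (2 * (2 * (S n * S n) + 2 * S n)))%nat by lia.
    rewrite pow_neg_even, pow_neg_odd.
    replace (- ((x ^ 2) ^ 2)) with (-1 * x ^ 4) by ring.
    rewrite (Rpow_mult_distr (-1) (x ^ 4) (S n * S n)), <- (pow_mult x 4).
    replace (4 * (S n * S n))%nat with (2 * (2 * (S n * S n)))%nat by lia.
    replace (- ((x ^ 2) ^ 2)) with (-1 * x ^ 4) in IH by ring.
    generalize (phim_coef_sign (S n)). intros E.
    rewrite <- (Rmult_assoc (phim_coef (S n))), E.
    match goal with |- ?a + ?b + ?c + (?d + ?e + ?f) = _ =>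
      replace (a + b + c + (d + e + f)) with (a + d + (b + c + (e + f))) by ring end.
    rewrite IH. ring.
Qed.

(** Even squares cancel, and (2j+1)^2 = 8 tri(j) + 1. *)
Lemma phi_minus_phim_fin (x : R) (n : nat) :
  sum_f_R0 (fun k => phim_coef k * (- x) ^ (k * k)) (2 * n + 1)
  - sum_f_R0 (fun k => phim_coef k * x ^ (k * k)) (2 * n + 1)
  = 4 * x * sum_f_R0 (fun k => (((x ^ 2) ^ 2) ^ 2) ^ tri k) n.
Proof.
  induction n as [|n IH].
  - simpl. ring.
  - replace (2 * S n + 1)%nat with (S (S (2 * n + 1))) by lia. rewrite !tech5.
    replace (S (S (2 * n + 1))) with (2 * S n + 1)%nat by lia.
    replace (S (2 * n + 1)) with (2 * S n)%nat by lia.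
    rewrite phim_coef_odd.
    replace (2 * S n * (2 * S n))%nat with (2 * (2 * (S n * S n)))%nat by lia.
    replace ((2 * S n + 1) * (2 * S n + 1))%nat with (S (2 * (4 * tri (S n))))%nat.
    2:{ clear IH. induction n as [|n IH]; [reflexivity | simpl in *; lia]. }
    rewrite pow_neg_even, pow_neg_odd.
    replace (((x ^ 2) ^ 2) ^ 2) with (x ^ 8) in * by ring.
    rewrite <- (pow_mult x 8).
    replace (x ^ S (2 * (4 * tri (S n)))) with (x * x ^ (8 * tri (S n)))
      by (rewrite tech_pow_Rmult; f_equal; lia).
    match goal with |- ?a + ?b + ?c - (?d + ?e + ?f) = _ =>
      replace (a + b + c - (d + e + f)) with (a - d + (b + c - (e + f))) by ring end.
    rewrite IH. ring.
Qed.

Lemma phim_partial_lim (x : R) :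
  Rabs x < 1 ->
  is_lim_seq (fun n => sum_f_R0 (fun k => phim_coef k * x ^ (k * k)) (2 * n + 1)) (phim x).
Proof.
  intros Hx.
  apply (is_lim_seq_subseq (fun n => sum_f_R0 (fun k => phim_coef k * x ^ (k * k)) n) _
           (fun n => (2 * n + 1)%nat)).
  - apply filterlim_affine. lia.
  - now apply gauss_square.
Qed.

Lemma phi_plus_phim (x : R) : Rabs x < 1 -> phi x + phim x = 2 * phi ((x ^ 2) ^ 2).
Proof.
  intros Hx.
  assert (Hm : Rabs (- x) < 1) by now rewrite Rabs_Ropp.
  assert (H4 : Rabs (- (x ^ 2) ^ 2) < 1) by (rewrite Rabs_Ropp; auto using Rabs_sqr_lt_1).
  apply (lim_seq_eq _ _ _ _
    (is_lim_seq_plus' _ _ _ _ (phim_partial_lim _ Hm) (phim_partial_lim _ Hx))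
    (is_lim_seq_scal_l _ 2 _ (gauss_square _ H4))).
  exact (phi_plus_phim_fin x).
Qed.

Lemma phi_minus_phim (x : R) :
  Rabs x < 1 -> phi x - phim x = 4 * x * psi (((x ^ 2) ^ 2) ^ 2).
Proof.
  intros Hx.
  assert (Hm : Rabs (- x) < 1) by now rewrite Rabs_Ropp.
  assert (H8 : Rabs (((x ^ 2) ^ 2) ^ 2) < 1) by auto using Rabs_sqr_lt_1.
  assert (L := is_lim_seq_minus' _ _ _ _ (phim_partial_lim _ Hm) (phim_partial_lim _ Hx)).
  apply (is_lim_seq_subseq _ _ (fun n => (2 * n + 1)%nat)) in L;
    [| apply filterlim_affine; lia].
  apply (lim_seq_eq _ _ _ _ L (is_lim_seq_scal_l _ (4 * x) _ (gauss_triangular _ H8))).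
  intros n. apply (phi_minus_phim_fin x (2 * n + 1)).
Qed.

(** * Differential equations of the theta functions *)

Definition alpha (q : R) : R := phi q ^ 2.
Definition beta (q : R) : R := phim q ^ 2.

Lemma alpha_pos (q : R) : Rabs q < 1 -> 0 < alpha q.
Proof. intros Hq. now apply pow_lt, phi_pos. Qed.

Lemma beta_pos (q : R) : Rabs q < 1 -> 0 < beta q.
Proof. intros Hq. now apply pow_lt, phim_pos. Qed.

Lemma analytic_alpha : analytic alpha.
Proof. apply analytic_pow, analytic_phi. Qed.

Lemma analytic_beta : analytic beta.
Proof. apply analytic_pow, analytic_phim. Qed.

Lemma qprod_0 : qprod 0 = 1.
Proof.
  assert (H : Rabs 0 < 1) by (rewrite Rabs_R0; lra).
  apply (lim_seq_eq _ (fun _ => 1) _ _ (qfin_lim 0 H) (is_lim_seq_const 1)).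
  induction n as [|n IH]; [reflexivity |]. rewrite qfin_S, IH. ring.
Qed.

Lemma alpha_0 : alpha 0 = 1.
Proof.
  unfold alpha, phi, phim. rewrite Ropp_0, pow_i, qprod_0 by lia. field.
Qed.

Lemma beta_0 : beta 0 = 1.
Proof. unfold beta, phim. rewrite pow_i, qprod_0 by lia. field. Qed.

Lemma psi_0 : psi 0 = 1.
Proof. unfold psi. rewrite pow_i, qprod_0 by lia. field. Qed.

Lemma beta_double (q : R) : Rabs q < 1 -> beta (q ^ 2) ^ 2 = alpha q * beta q.
Proof.
  intros Hq. unfold alpha, beta. rewrite <- phi_mul_phim by exact Hq. ring.
Qed.

Lemma alpha_sub_beta (q : R) :
  Rabs q < 1 -> alpha q - beta q = 8 * q * psi ((q ^ 2) ^ 2) ^ 2.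
Proof.
  intros Hq. unfold alpha, beta.
  rewrite <- (phi_mul_psi ((q ^ 2) ^ 2)) by auto using Rabs_sqr_lt_1.
  transitivity ((phi q + phim q) * (phi q - phim q)); [ring |].
  rewrite phi_plus_phim, phi_minus_phim by exact Hq. ring.
Qed.

Lemma doubling_invariant (u : R -> R) (l : R) :
  (forall s, s <> 0 -> Rabs s < 1 -> u (s ^ 2) = u s) -> is_lim u 0 l ->
  forall s, s <> 0 -> Rabs s < 1 -> u s = l.
Proof.
  intros Hu Hl s Hs0 Hs.
  assert (H : forall n, s ^ (2 ^ n) <> 0 /\ Rabs (s ^ (2 ^ n)) < 1 /\ u (s ^ (2 ^ n)) = u s).
  { induction n as [|n (IH1 & IH2 & IH3)].
    - simpl. rewrite Rmult_1_r. auto.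
    - replace (2 ^ S n)%nat with (2 ^ n * 2)%nat by (simpl; lia).
      rewrite pow_mult. split; [now apply pow_nonzero |].
      split; [now apply Rabs_sqr_lt_1 |]. rewrite <- IH3. now apply Hu. }
  assert (L : is_lim_seq (fun n => u (s ^ (2 ^ n))) l).
  { apply (is_lim_comp_seq u _ 0 l Hl).
    - exists O. intros n _ E. injection E. apply H.
    - apply (is_lim_seq_subseq (fun n => s ^ n) 0 (fun n => (2 ^ n)%nat)).
      + intros P [N HN]. exists N. intros n Hn. apply HN.
        generalize (Nat.pow_gt_lin_r 2 n). lia.
      + now apply is_lim_seq_geom. }
  apply (lim_seq_eq _ _ _ _ (is_lim_seq_const (u s)) L).
  intros n. symmetry. apply H.
Qed.

Lemma is_lim_continuity_eq (f : R -> R) (x l : R) : continuity_pt f x -> f x = l -> is_lim f x l.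
Proof. intros Hc <-. now apply is_lim_continuity. Qed.

Lemma analytic_square (f : R -> R) (x : R) :
  analytic f -> Rabs x < 1 -> continuity_pt (fun y => f (y ^ 2)) x.
Proof.
  intros Hf Hx. apply (continuity_pt_comp (fun y => y ^ 2) f).
  - apply derivable_continuous_pt, derivable_pt_pow.
  - apply analytic_continuity_pt; [exact Hf | now apply Rabs_sqr_lt_1].
Qed.

Lemma Rabs_0_lt_1 : Rabs 0 < 1.
Proof. rewrite Rabs_R0. lra. Qed.

(* The defect changes sign under [q -> q^2] and vanishes at 0. *)
Lemma alpha_double (q : R) : Rabs q < 1 -> 2 * alpha (q ^ 2) = alpha q + beta q.
Proof.
  intros Hq.
  set (delta := fun s => alpha s + beta s - 2 * alpha (s ^ 2)).
  assert (Hd : forall s, Rabs s < 1 -> delta (s ^ 2) = - delta s).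
  { intros s Hs. unfold delta.
    assert (E := alpha_sub_beta (s ^ 2) (Rabs_sqr_lt_1 s Hs)).
    assert (E' : alpha s + beta s
                 = 2 * alpha ((s ^ 2) ^ 2) + 8 * s ^ 2 * psi (((s ^ 2) ^ 2) ^ 2) ^ 2).
    { unfold alpha at 1, beta.
      replace (phi s ^ 2 + phim s ^ 2)
        with (((phi s + phim s) ^ 2 + (phi s - phim s) ^ 2) / 2) by field.
      rewrite phi_plus_phim, phi_minus_phim by exact Hs. unfold alpha. field. }
    lra. }
  destruct (Req_dec q 0) as [-> | Hq0].
  { rewrite pow_i, alpha_0, beta_0 by lia. ring. }
  (* The absolute value turns the change of sign into invariance. *)
  assert (H : Rabs (delta q) = 0).
  { apply (doubling_invariant (fun s => Rabs (delta s)) 0); [| | exact Hq0 | exact Hq].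
    - intros s _ Hs. rewrite Hd by exact Hs. apply Rabs_Ropp.
    - apply is_lim_continuity_eq.
      + apply (continuity_pt_comp delta Rabs); [| apply Rcontinuity_abs].
        apply (continuity_pt_minus (fun s => alpha s + beta s) (fun s => 2 * alpha (s ^ 2))).
        * apply (continuity_pt_plus alpha beta);
            apply analytic_continuity_pt; auto using analytic_alpha, analytic_beta, Rabs_0_lt_1.
        * apply (continuity_pt_scal (fun s => alpha (s ^ 2))).
          apply analytic_square; auto using analytic_alpha, Rabs_0_lt_1.
      + unfold delta. rewrite pow_i, alpha_0, beta_0 by lia.
        replace (1 + 1 - 2 * 1) with 0 by ring. apply Rabs_R0. }
  destruct (Req_dec (delta q) 0) as [E | E]; [unfold delta in E; lra |].
  now apply Rabs_no_R0 in E.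
Qed.

(** Jacobi's quartic identity phi(q)^4 - phi(-q)^4 = 16 q psi(q^2)^4. It exhibits the simple zero at
    q = 0 that is cancelled in later limits. *)
Lemma alpha_sqr_sub_beta_sqr (q : R) :
  Rabs q < 1 -> alpha q ^ 2 - beta q ^ 2 = 16 * q * psi (q ^ 2) ^ 4.
Proof.
  intros Hq.
  replace (psi (q ^ 2) ^ 4) with ((psi (q ^ 2) ^ 2) ^ 2) by ring.
  rewrite <- (phi_mul_psi (q ^ 2)) by now apply Rabs_sqr_lt_1.
  replace (alpha q ^ 2 - beta q ^ 2) with ((alpha q - beta q) * (alpha q + beta q)) by ring.
  rewrite alpha_sub_beta, <- alpha_double by exact Hq. unfold alpha. ring.
Qed.

Lemma alpha_sqr_ne_beta_sqr (q : R) : Rabs q < 1 -> q <> 0 -> alpha q ^ 2 - beta q ^ 2 <> 0.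
Proof.
  intros Hq Hq0. rewrite alpha_sqr_sub_beta_sqr by exact Hq.
  assert (H := psi_pos _ (Rabs_sqr_lt_1 q Hq)).
  apply Rmult_integral_contrapositive_currified; [lra | apply pow_nonzero; lra].
Qed.

Lemma psi_pow8 (q : R) :
  Rabs q < 1 -> 64 * q * psi q ^ 8 = 4 * alpha q ^ 2 * (alpha q ^ 2 - beta q ^ 2).
Proof.
  intros Hq. rewrite alpha_sqr_sub_beta_sqr by exact Hq.
  replace (psi q ^ 8) with ((psi q ^ 2) ^ 4) by ring.
  rewrite <- (phi_mul_psi q) by exact Hq. unfold alpha. ring.
Qed.

(* [is_euler f s e]: the Euler derivative [q d/dq f] takes the value [e] at [q = s]. *)
Definition is_euler (f : R -> R) (s e : R) : Prop :=
  exists d, is_derive f s d /\ s * d = e.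

Lemma is_derive_unique_R (f : R -> R) (x a b : R) : is_derive f x a -> is_derive f x b -> a = b.
Proof. intros Ha Hb. apply is_derive_unique in Ha. apply is_derive_unique in Hb. congruence. Qed.

Lemma is_euler_unique (f : R -> R) (s a b : R) : is_euler f s a -> is_euler f s b -> a = b.
Proof.
  intros [d [Hd <-]] [d' [Hd' <-]]. f_equal. now apply (is_derive_unique_R f s).
Qed.

Lemma is_euler_eq (f : R -> R) (s a b : R) : is_euler f s a -> a = b -> is_euler f s b.
Proof. now intros H <-. Qed.

Lemma is_euler_ext (f g : R -> R) (s e : R) :
  locally s (fun t => f t = g t) -> is_euler f s e -> is_euler g s e.
Proof.
  intros E [d [Hd <-]]. exists d. split; [| reflexivity].
  now apply (is_derive_ext_loc f).
Qed.

Lemma is_euler_const (c s : R) : is_euler (fun _ => c) s 0.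
Proof. exists 0. split; [apply (is_derive_const (V := R_NormedModule)) | ring]. Qed.

Lemma is_euler_plus (f g : R -> R) (s a b : R) :
  is_euler f s a -> is_euler g s b -> is_euler (fun t => f t + g t) s (a + b).
Proof.
  intros [d [Hd <-]] [d' [Hd' <-]]. exists (d + d'). split; [| ring].
  now apply (is_derive_plus (V := R_NormedModule) f g).
Qed.

Lemma is_euler_minus (f g : R -> R) (s a b : R) :
  is_euler f s a -> is_euler g s b -> is_euler (fun t => f t - g t) s (a - b).
Proof.
  intros [d [Hd <-]] [d' [Hd' <-]]. exists (d - d'). split; [| ring].
  now apply (is_derive_minus (V := R_NormedModule) f g).
Qed.

Lemma is_euler_mult (f g : R -> R) (s a b : R) :
  is_euler f s a -> is_euler g s b ->
  is_euler (fun t => f t * g t) s (a * g s + f s * b).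
Proof.
  intros [d [Hd <-]] [d' [Hd' <-]]. exists (d * g s + f s * d'). split; [| ring].
  apply (is_derive_mult f g s d d' Hd Hd'). intros; apply Rmult_comm.
Qed.

Lemma is_euler_inv (f : R -> R) (s a : R) :
  is_euler f s a -> f s <> 0 -> is_euler (fun t => / f t) s (- a / f s ^ 2).
Proof.
  intros [d [Hd <-]] H. exists (- d / f s ^ 2). split; [| field; exact H].
  now apply is_derive_inv.
Qed.

Lemma is_euler_div (f g : R -> R) (s a b : R) :
  is_euler f s a -> is_euler g s b -> g s <> 0 ->
  is_euler (fun t => f t / g t) s ((a * g s - f s * b) / g s ^ 2).
Proof.
  intros Hf Hg H. apply (is_euler_eq _ _ _ _ (is_euler_mult _ _ _ _ _ Hf (is_euler_inv _ _ _ Hg H))).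
  field. exact H.
Qed.

Lemma is_euler_pow (f : R -> R) (n : nat) (s a : R) :
  is_euler f s a -> is_euler (fun t => f t ^ n) s (INR n * f s ^ pred n * a).
Proof.
  intros [d [Hd <-]]. exists (INR n * d * f s ^ pred n). split; [| ring].
  now apply is_derive_pow.
Qed.

Lemma is_euler_comp (F f : R -> R) (s dF a : R) :
  is_derive F (f s) dF -> is_euler f s a -> is_euler (fun t => F (f t)) s (a * dF).
Proof.
  intros HF [d [Hd <-]]. exists (d * dF). split; [| ring].
  now apply (is_derive_comp F f).
Qed.

(* The Euler derivative of [ln (alpha / beta)], by [log_deriv_diff]. *)
Definition Dlog (q : R) : R := (alpha q ^ 2 - beta q ^ 2) / 2.

Lemma is_derive_square_comp (f : R -> R) (s d : R) :
  is_derive f (s ^ 2) d -> is_derive (fun t => f (t ^ 2)) s (2 * s * d).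
Proof.
  intros H. apply (is_derive_comp f (fun t => t ^ 2) s d (2 * s) H).
  auto_derive; [exact I | ring].
Qed.

(** * Differential equations forced by the doubling formulas *)

Section ThetaODE.
Variables (a' b' : R -> R).
Hypothesis Ha' : forall x, Rabs x < 1 -> is_derive alpha x (a' x).
Hypothesis Hb' : forall x, Rabs x < 1 -> is_derive beta x (b' x).
Hypothesis Aa' : analytic a'.
Hypothesis Ab' : analytic b'.

Lemma alpha_deriv_double (s : R) : Rabs s < 1 -> 4 * s * a' (s ^ 2) = a' s + b' s.
Proof.
  intros Hs.
  apply (is_derive_unique_R (fun t => 2 * alpha (t ^ 2)) s).
  - replace (4 * s * a' (s ^ 2)) with (2 * (2 * s * a' (s ^ 2))) by ring.
    apply (is_derive_scal (fun t => alpha (t ^ 2)) s 2).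
    apply is_derive_square_comp, Ha', Rabs_sqr_lt_1, Hs.
  - apply (is_derive_ext_loc (fun t => alpha t + beta t)).
    + generalize (locally_disk s Hs). apply filter_imp. intros t Ht. symmetry. now apply alpha_double.
    + apply (is_derive_plus (V := R_NormedModule) alpha beta); auto.
Qed.

Lemma beta_deriv_double (s : R) :
  Rabs s < 1 ->
  4 * s * beta (s ^ 2) * b' (s ^ 2) = a' s * beta s + alpha s * b' s.
Proof.
  intros Hs.
  apply (is_derive_unique_R (fun t => beta (t ^ 2) ^ 2) s).
  - replace (4 * s * beta (s ^ 2) * b' (s ^ 2))
      with (INR 2 * (2 * s * b' (s ^ 2)) * beta (s ^ 2) ^ pred 2) by (simpl; ring).
    apply (is_derive_pow (fun t => beta (t ^ 2)) 2).
    apply is_derive_square_comp, Hb', Rabs_sqr_lt_1, Hs.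
  - apply (is_derive_ext_loc (fun t => alpha t * beta t)).
    + generalize (locally_disk s Hs). apply filter_imp. intros t Ht. symmetry. now apply beta_double.
    + apply (is_derive_mult alpha beta s _ _ (Ha' s Hs) (Hb' s Hs)).
      intros; apply Rmult_comm.
Qed.

(** Read off from alpha - beta = 8 q psi(q^4)^2. Against the 16 of Jacobi's identity it gives the
    limit 1/2, the constant in [Dlog]. *)
Lemma alpha_beta_deriv_0 : a' 0 - b' 0 = 8.
Proof.
  apply (is_derive_unique_R (fun t => alpha t - beta t) 0).
  - apply (is_derive_minus (V := R_NormedModule) alpha beta); auto using Rabs_0_lt_1.
  - apply (is_derive_ext_loc (fun t => t * (8 * psi ((t ^ 2) ^ 2) ^ 2))).
    + generalize (locally_disk 0 Rabs_0_lt_1). apply filter_imp. intros t Ht.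
      rewrite alpha_sub_beta by exact Ht. simpl. ring.
    + destruct (analytic_derive psi analytic_psi) as [p' [_ Hp]].
      assert (H0 : is_derive psi ((0 ^ 2) ^ 2) (p' ((0 ^ 2) ^ 2)))
        by (apply Hp; rewrite !pow_i by lia; apply Rabs_0_lt_1).
      assert (H1 := is_derive_square_comp (fun t => psi (t ^ 2)) 0 _
        (is_derive_square_comp psi (0 ^ 2) _ H0)).
      assert (H2 := is_derive_pow _ 2 _ _ H1).
      assert (H3 := is_derive_scal _ 0 8 _ H2).
      assert (H4 := is_derive_mult (fun t => t) _ 0 1 _ (is_derive_id 0) H3
        (fun x y => Rmult_comm x y)).
      eapply is_derive_ext; [| replace 8 with (1 * (8 * psi ((0 ^ 2) ^ 2) ^ 2)
         + 0 * (8 * (INR 2 * (2 * 0 * (2 * 0 ^ 2 * p' ((0 ^ 2) ^ 2))) * psi ((0 ^ 2) ^ 2) ^ pred 2)));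
         [exact H4 |]].
      * reflexivity.
      * rewrite !pow_i, psi_0 by lia. ring.
Qed.

(** The quotient of theta ln(alpha/beta) by alpha^2 - beta^2 is invariant under q -> q^2. In [w] a
    factor q has been cancelled from numerator and denominator by Jacobi's identity, which makes the
    limit at 0 an evaluation. *)
Lemma log_deriv_diff (s : R) :
  Rabs s < 1 ->
  s * (a' s * beta s - alpha s * b' s) = alpha s * beta s * Dlog s.
Proof.
  intros Hs. destruct (Req_dec s 0) as [-> | Hs0].
  { unfold Dlog. rewrite alpha_0, beta_0. field. }
  set (w := fun s => (a' s * beta s - alpha s * b' s)
                     / (alpha s * beta s * (16 * psi (s ^ 2) ^ 4))).
  assert (Hw : forall t, t <> 0 -> Rabs t < 1 ->
     w t = t * (a' t * beta t - alpha t * b' t)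
           / (alpha t * beta t * (alpha t ^ 2 - beta t ^ 2))).
  { intros t Ht0 Ht. unfold w. rewrite alpha_sqr_sub_beta_sqr by exact Ht.
    assert (H1 := alpha_pos t Ht). assert (H2 := beta_pos t Ht).
    assert (H3 := psi_pos _ (Rabs_sqr_lt_1 t Ht)).
    field. repeat split; lra. }
  assert (E : w s = 1 / 2).
  { apply (doubling_invariant w); [| | exact Hs0 | exact Hs].
    - intros t Ht0 Ht.
      assert (Ht2 := Rabs_sqr_lt_1 t Ht).
      rewrite !Hw by (try assumption; now apply pow_nonzero).
      assert (H1 := alpha_pos t Ht). assert (H2 := beta_pos t Ht).
      assert (H3 := beta_pos _ Ht2).
      assert (D0 := alpha_sqr_ne_beta_sqr t Ht Ht0).
      assert (D1 : alpha t - beta t <> 0) by (intros E; apply D0; nra).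
      assert (Eb := beta_double t Ht).
      assert (Ea' : a' (t ^ 2) = (a' t + b' t) / (4 * t))
        by (rewrite <- alpha_deriv_double by exact Ht; field; exact Ht0).
      assert (Eb' : b' (t ^ 2) = (a' t * beta t + alpha t * b' t) / (4 * t * beta (t ^ 2)))
        by (rewrite <- beta_deriv_double by exact Ht; field; split; [lra | exact Ht0]).
      rewrite Ea', Eb'.
      replace (alpha (t ^ 2)) with ((alpha t + beta t) / 2)
        by (rewrite <- alpha_double by exact Ht; field).
      rewrite Eb.
      (* [beta (t ^ 2)] is a square root of [alpha t * beta t]; it stays an atom until only its
         square is left, which [Eb] then replaces. *)
      set (b2 := beta (t ^ 2)) in *.
      transitivity (t ^ 2 * ((a' t + b' t) / (4 * t) * b2 ^ 2
          - (alpha t + beta t) / 2 * ((a' t * beta t + alpha t * b' t) / (4 * t)))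
          / ((alpha t + beta t) / 2 * b2 ^ 2 * (((alpha t + beta t) / 2) ^ 2 - alpha t * beta t))).
      + field. repeat split; try lra.
        intros E0. apply (pow_nonzero _ 2 D1). lra.
      + rewrite Eb. field.
        repeat split; try lra; intros E0; apply (pow_nonzero _ 2 D1); lra.
    - apply is_lim_continuity_eq.
      + assert (C := fun f Hf => analytic_continuity_pt f 0 Hf Rabs_0_lt_1).
        apply (continuity_pt_div (fun s => a' s * beta s - alpha s * b' s)
                 (fun s => alpha s * beta s * (16 * psi (s ^ 2) ^ 4))).
        * apply C, analytic_minus; apply analytic_mult;
            auto using analytic_alpha, analytic_beta.
        * apply (continuity_pt_mult (fun s => alpha s * beta s) (fun s => 16 * psi (s ^ 2) ^ 4)).
          -- apply C, analytic_mult; auto using analytic_alpha, analytic_beta.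
          -- apply (analytic_square (fun y => 16 * psi y ^ 4)); [| apply Rabs_0_lt_1].
             apply analytic_mult; [apply analytic_const | apply analytic_pow, analytic_psi].
        * rewrite pow_i, alpha_0, beta_0, psi_0 by lia. lra.
      + unfold w. rewrite pow_i, alpha_0, beta_0, psi_0 by lia.
        replace (a' 0 * 1 - 1 * b' 0) with 8 by (generalize alpha_beta_deriv_0; lra). field. }
  rewrite Hw in E by assumption.
  assert (H1 := alpha_pos s Hs). assert (H2 := beta_pos s Hs).
  assert (D0 := alpha_sqr_ne_beta_sqr s Hs Hs0).
  set (n := s * (a' s * beta s - alpha s * b' s)) in *.
  replace n with (n / (alpha s * beta s * (alpha s ^ 2 - beta s ^ 2))
     * (alpha s * beta s * (alpha s ^ 2 - beta s ^ 2))) by (field; repeat split; lra).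
  rewrite E. unfold Dlog. field.
Qed.

(* The Euler derivative of [ln (alpha beta)]. *)
Definition Mlog (s : R) : R := s * (a' s / alpha s + b' s / beta s).

(** Logarithmic differentiation of alpha(q^2) beta(q^2) = (alpha + beta)/2 * sqrt(alpha beta), the 2
    being the chain rule for q^2. The correction term is the part of theta ln(alpha + beta) that
    comes from [Dlog]. *)
Lemma Mlog_double (s : R) :
  Rabs s < 1 -> 2 * Mlog (s ^ 2) = Mlog s + (alpha s - beta s) ^ 2 / 4.
Proof.
  intros Hs. destruct (Req_dec s 0) as [-> | Hs0].
  { unfold Mlog. rewrite pow_i, alpha_0, beta_0 by lia. field. }
  assert (H1 := alpha_pos s Hs). assert (H2 := beta_pos s Hs).
  assert (H3 := beta_pos _ (Rabs_sqr_lt_1 s Hs)).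
  assert (W := log_deriv_diff s Hs). unfold Dlog in W.
  assert (Eb := beta_double s Hs).
  assert (Ea' : a' (s ^ 2) = (a' s + b' s) / (4 * s))
    by (rewrite <- alpha_deriv_double by exact Hs; field; exact Hs0).
  assert (Eb' : b' (s ^ 2) = (a' s * beta s + alpha s * b' s) / (4 * s * beta (s ^ 2)))
    by (rewrite <- beta_deriv_double by exact Hs; field; lra).
  unfold Mlog. rewrite Ea', Eb'.
  replace (alpha (s ^ 2)) with ((alpha s + beta s) / 2)
    by (rewrite <- alpha_double by exact Hs; field).
  set (b2 := beta (s ^ 2)) in *.
  transitivity (s * ((a' s + b' s) / (alpha s + beta s))
                + s * (a' s * beta s + alpha s * b' s) / (2 * b2 ^ 2)).
  { field. repeat split; lra. }
  rewrite Eb.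
  replace (a' s) with ((alpha s * b' s * s + alpha s * beta s * ((alpha s ^ 2 - beta s ^ 2) / 2))
     / (beta s * s)) by (rewrite <- W; field; lra).
  field. repeat split; lra.
Qed.

Variables (a'' b'' : R -> R).
Hypothesis Ha'' : forall x, Rabs x < 1 -> is_derive a' x (a'' x).
Hypothesis Hb'' : forall x, Rabs x < 1 -> is_derive b' x (b'' x).
Hypothesis Aa'' : analytic a''.
Hypothesis Ab'' : analytic b''.

Definition Mlog' (s : R) : R :=
  (a' s / alpha s + b' s / beta s)
  + s * ((a'' s * alpha s - a' s * a' s) / alpha s ^ 2
         + (b'' s * beta s - b' s * b' s) / beta s ^ 2).

Lemma is_derive_Mlog (s : R) : Rabs s < 1 -> is_derive Mlog s (Mlog' s).
Proof.
  intros Hs. unfold Mlog, Mlog'.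
  assert (H1 := alpha_pos s Hs). assert (H2 := beta_pos s Hs).
  assert (Da := is_derive_div a' alpha s _ _ (Ha'' s Hs) (Ha' s Hs) (Rgt_not_eq _ _ H1)).
  assert (Db := is_derive_div b' beta s _ _ (Hb'' s Hs) (Hb' s Hs) (Rgt_not_eq _ _ H2)).
  assert (Dm := is_derive_mult (fun t => t) _ s 1 _ (is_derive_id s)
    (is_derive_plus _ _ _ _ _ Da Db) (fun x y => Rmult_comm x y)).
  match type of Dm with is_derive _ _ ?d =>
    match goal with |- is_derive _ _ ?e => replace e with d end end; [exact Dm |].
  unfold plus, mult; simpl. field. lra.
Qed.

Lemma Mlog'_double (s : R) :
  Rabs s < 1 -> 4 * s * Mlog' (s ^ 2) = Mlog' s + (alpha s - beta s) * (a' s - b' s) / 2.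
Proof.
  intros Hs.
  apply (is_derive_unique_R (fun t => 2 * Mlog (t ^ 2)) s).
  - replace (4 * s * Mlog' (s ^ 2)) with (2 * (2 * s * Mlog' (s ^ 2))) by ring.
    apply (is_derive_scal (fun t => Mlog (t ^ 2)) s 2).
    apply is_derive_square_comp, is_derive_Mlog, Rabs_sqr_lt_1, Hs.
  - apply (is_derive_ext_loc (fun t => Mlog t + (alpha t - beta t) ^ 2 * / 4)).
    + generalize (locally_disk s Hs). apply filter_imp. intros t Ht. symmetry. now apply Mlog_double.
    + apply (is_derive_plus (V := R_NormedModule) Mlog (fun t => (alpha t - beta t) ^ 2 * / 4)).
      * now apply is_derive_Mlog.
      * assert (Ds := is_derive_minus (V := R_NormedModule) alpha beta s _ _ (Ha' s Hs) (Hb' s Hs)).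
        assert (Dp := is_derive_pow _ 2 _ _ Ds).
        assert (Dq := is_derive_scal_l _ s _ (/ 4) Dp).
        replace ((alpha s - beta s) * (a' s - b' s) / 2) with
          (INR 2 * (a' s - b' s) * (alpha s - beta s) ^ pred 2 * / 4) by (simpl; field).
        exact Dq.
Qed.

Lemma continuity_pt_quotient_0 (f g : R -> R) :
  analytic f -> analytic g -> g 0 = 1 -> continuity_pt (fun t => f t / g t) 0.
Proof.
  intros Hf Hg E. apply (continuity_pt_div f g);
    try (apply analytic_continuity_pt; [assumption | apply Rabs_0_lt_1]). lra.
Qed.

Lemma continuity_log_deriv : continuity_pt (fun s => a' s / alpha s + b' s / beta s) 0.
Proof.
  apply (continuity_pt_plus (fun s => a' s / alpha s) (fun s => b' s / beta s));
    apply continuity_pt_quotient_0; auto using analytic_alpha, analytic_beta, alpha_0, beta_0.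
Qed.

Lemma continuity_Mlog' : continuity_pt Mlog' 0.
Proof.
  unfold Mlog'.
  apply (continuity_pt_plus (fun s => a' s / alpha s + b' s / beta s)
    (fun s => s * ((a'' s * alpha s - a' s * a' s) / alpha s ^ 2
         + (b'' s * beta s - b' s * b' s) / beta s ^ 2))); [apply continuity_log_deriv |].
  apply (continuity_pt_mult (fun s => s)); [apply derivable_continuous_pt, derivable_pt_id |].
  apply (continuity_pt_plus (fun s => (a'' s * alpha s - a' s * a' s) / alpha s ^ 2)
           (fun s => (b'' s * beta s - b' s * b' s) / beta s ^ 2)).
  - apply (continuity_pt_quotient_0 (fun s => a'' s * alpha s - a' s * a' s) (fun s => alpha s ^ 2)).
    + apply analytic_minus; apply analytic_mult; auto using analytic_alpha.
    + apply analytic_pow, analytic_alpha.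
    + rewrite alpha_0. ring.
  - apply (continuity_pt_quotient_0 (fun s => b'' s * beta s - b' s * b' s) (fun s => beta s ^ 2)).
    + apply analytic_minus; apply analytic_mult; auto using analytic_beta.
    + apply analytic_pow, analytic_beta.
    + rewrite beta_0. ring.
Qed.

Lemma euler_alpha (s : R) :
  Rabs s < 1 -> s * a' s = alpha s * (Mlog s + Dlog s) / 2.
Proof.
  intros Hs. assert (W := log_deriv_diff s Hs).
  assert (H1 := alpha_pos s Hs). assert (H2 := beta_pos s Hs).
  replace (Dlog s) with (s * (a' s * beta s - alpha s * b' s) / (alpha s * beta s))
    by (rewrite W; field; lra).
  unfold Mlog. field. lra.
Qed.

Lemma euler_beta (s : R) :
  Rabs s < 1 -> s * b' s = beta s * (Mlog s - Dlog s) / 2.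
Proof.
  intros Hs. assert (W := log_deriv_diff s Hs).
  assert (H1 := alpha_pos s Hs). assert (H2 := beta_pos s Hs).
  replace (Dlog s) with (s * (a' s * beta s - alpha s * b' s) / (alpha s * beta s))
    by (rewrite W; field; lra).
  unfold Mlog. field. lra.
Qed.

(* [rho := 2 q dM/dq - M^2 + D^2] satisfies [4 rho(q^2) = rho(q)], so that
   [|rho| ln^2 |q|] is invariant under [q -> q^2]. *)
Lemma euler_Mlog (s : R) :
  Rabs s < 1 -> s * Mlog' s = (Mlog s ^ 2 - Dlog s ^ 2) / 2.
Proof.
  intros Hs. destruct (Req_dec s 0) as [-> | Hs0].
  { unfold Mlog, Dlog. rewrite alpha_0, beta_0. field. }
  set (rho := fun s => 2 * (s * Mlog' s) - Mlog s ^ 2 + Dlog s ^ 2).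
  assert (Hrho : forall t, Rabs t < 1 -> 4 * rho (t ^ 2) = rho t).
  { intros t Ht. unfold rho.
    assert (E1 := Mlog_double t Ht). assert (E2 := Mlog'_double t Ht).
    assert (E3 := euler_alpha t Ht). assert (E4 := euler_beta t Ht).
    assert (E5 : Dlog (t ^ 2) = (alpha t - beta t) ^ 2 / 8).
    { unfold Dlog. rewrite beta_double by exact Ht.
      replace (alpha (t ^ 2)) with ((alpha t + beta t) / 2)
        by (rewrite <- alpha_double by exact Ht; field). field. }
    replace (4 * (2 * (t ^ 2 * Mlog' (t ^ 2)) - Mlog (t ^ 2) ^ 2 + Dlog (t ^ 2) ^ 2))
      with (2 * t * (4 * t * Mlog' (t ^ 2)) - (2 * Mlog (t ^ 2)) ^ 2 + 4 * Dlog (t ^ 2) ^ 2) by ring.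
    rewrite E1, E2, E5.
    replace (2 * t * (Mlog' t + (alpha t - beta t) * (a' t - b' t) / 2))
      with (2 * t * Mlog' t + (alpha t - beta t) * (t * a' t - t * b' t)) by field.
    rewrite E3, E4. unfold Dlog. field. }
  (* [sigma] is [rho] with its factor q removed. Being continuous at 0, it shows rho = O(q), which
     outweighs the squared logarithm. *)
  set (sigma := fun t => 2 * Mlog' t - Mlog t * (a' t / alpha t + b' t / beta t)
                         + Dlog t * (8 * psi (t ^ 2) ^ 4)).
  assert (Hsigma : forall t, Rabs t < 1 -> rho t = t * sigma t).
  { intros t Ht. unfold rho, sigma, Dlog.
    rewrite alpha_sqr_sub_beta_sqr by exact Ht. unfold Mlog. field.
    generalize (alpha_pos t Ht) (beta_pos t Ht). lra. }
  assert (Hs0c : continuity_pt sigma 0).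
  { apply (continuity_pt_plus (fun t => 2 * Mlog' t - Mlog t * (a' t / alpha t + b' t / beta t))
             (fun t => Dlog t * (8 * psi (t ^ 2) ^ 4))).
    - apply (continuity_pt_minus (fun t => 2 * Mlog' t)
               (fun t => Mlog t * (a' t / alpha t + b' t / beta t))).
      + apply (continuity_pt_scal Mlog'), continuity_Mlog'.
      + apply (continuity_pt_mult Mlog); [| apply continuity_log_deriv].
        apply (is_derive_continuity_pt _ _ _ (is_derive_Mlog 0 Rabs_0_lt_1)).
    - apply (continuity_pt_mult Dlog (fun t => 8 * psi (t ^ 2) ^ 4)).
      + apply analytic_continuity_pt; [| apply Rabs_0_lt_1].
        apply (analytic_mult (fun q => alpha q ^ 2 - beta q ^ 2) (fun _ => / 2));
          [| apply analytic_const].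
        apply analytic_minus; apply analytic_pow; auto using analytic_alpha, analytic_beta.
      + apply (analytic_square (fun y => 8 * psi y ^ 4)); [| apply Rabs_0_lt_1].
        apply analytic_mult; [apply analytic_const | apply analytic_pow, analytic_psi]. }
  assert (Hln : forall t, t <> 0 -> Rabs t < 1 -> ln (Rabs t) < 0).
  { intros t Ht0 Ht. rewrite <- ln_1. apply ln_increasing; [now apply Rabs_pos_lt | exact Ht]. }
  assert (E : Rabs (rho s) * ln (Rabs s) ^ 2 = 0).
  { apply (doubling_invariant (fun t => Rabs (rho t) * ln (Rabs t) ^ 2));
      [| | exact Hs0 | exact Hs].
    - intros t Ht0 Ht. rewrite <- (Hrho t Ht), Rabs_mult, (Rabs_pos_eq 4) by lra.
      rewrite <- RPow_abs. replace (Rabs t ^ 2) with (Rabs t * Rabs t) by ring.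
      assert (Hp := Rabs_pos_lt t Ht0). rewrite ln_mult by exact Hp. ring.
    - apply (is_lim_le_le_loc (fun _ => 0) (fun t => Rabs (sigma t) * (16 * sqrt (Rabs t)))).
      + generalize (locally_disk 0 Rabs_0_lt_1). unfold Rbar_locally', locally', within.
        apply filter_imp. intros t Ht Ht0. split.
        { apply Rmult_le_pos; [apply Rabs_pos | apply pow2_ge_0]. }
        rewrite Hsigma, Rabs_mult by exact Ht.
        replace (Rabs t * Rabs (sigma t) * ln (Rabs t) ^ 2)
          with (Rabs (sigma t) * (Rabs t * ln (Rabs t) ^ 2)) by ring.
        apply Rmult_le_compat_l; [apply Rabs_pos |].
        (* The bound is y ln^2 y <= 16 sqrt y, from - w ln w <= 1 at the fourth root w of y. *)
        set (y := Rabs t). assert (Hy : 0 < y) by now apply Rabs_pos_lt.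
        assert (H1 := sqrt_lt_R0 y Hy). assert (H2 := sqrt_lt_R0 _ H1).
        set (w := sqrt (sqrt y)) in *.
        assert (Ew : w * w = sqrt y) by (apply sqrt_sqrt; lra).
        assert (Ey : sqrt y * sqrt y = y) by (apply sqrt_sqrt; lra).
        assert (Ely : ln y = 4 * ln w).
        { rewrite <- Ey, <- Ew, !ln_mult by (try apply Rmult_lt_0_compat; exact H2). ring. }
        assert (Hy1 : ln y < 0) by now apply Hln.
        assert (Hw : - ln w * w <= 1).
        { rewrite <- ln_Rinv by exact H2.
          generalize (exp_ineq1_le (ln (/ w))).
          rewrite exp_ln by now apply Rinv_0_lt_compat. intros H.
          replace 1 with (/ w * w) by (field; lra). apply Rmult_le_compat_r; lra. }
        rewrite Ely. replace (y * (4 * ln w) ^ 2) with (16 * (w * w) * (- ln w * w) ^ 2)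
          by (rewrite <- Ey, <- Ew; ring).
        rewrite Ew. assert (0 <= - ln w * w) by (apply Rmult_le_pos; lra).
        assert ((- ln w * w) ^ 2 <= 1) by nra. nra.
      + apply is_lim_const.
      + apply is_lim_continuity_eq; [| rewrite Rabs_R0, sqrt_0; ring].
        apply (continuity_pt_mult (fun t => Rabs (sigma t)) (fun t => 16 * sqrt (Rabs t))).
        * apply (continuity_pt_comp sigma Rabs); [exact Hs0c | apply Rcontinuity_abs].
        * apply (continuity_pt_scal (fun t => sqrt (Rabs t))).
          apply (continuity_pt_comp Rabs sqrt); [apply Rcontinuity_abs |].
          apply continuity_pt_sqrt, Rabs_pos. }
  assert (Hl := Hln s Hs0 Hs).
  assert (E0 : Rabs (rho s) = 0).
  { apply Rmult_integral in E. destruct E as [E | E]; [exact E |].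
    exfalso. apply (pow_nonzero (ln (Rabs s)) 2); [lra | exact E]. }
  destruct (Req_dec (rho s) 0) as [E1 | E1]; [unfold rho in E1; lra |].
  now apply Rabs_no_R0 in E1.
Qed.

End ThetaODE.

(** The polynomial ring in alpha, beta and M is closed under q d/dq. All later derivatives are
    computed from these three equations, which reduces their verification to field identities. *)
Theorem theta_ode :
  exists M : R -> R, forall s, Rabs s < 1 ->
    is_euler alpha s (alpha s * (M s + Dlog s) / 2) /\
    is_euler beta s (beta s * (M s - Dlog s) / 2) /\
    is_euler M s ((M s ^ 2 - Dlog s ^ 2) / 2).
Proof.
  destruct (analytic_derive _ analytic_alpha) as [a' [Aa' Ha']].
  destruct (analytic_derive _ analytic_beta) as [b' [Ab' Hb']].
  destruct (analytic_derive _ Aa') as [a'' [Aa'' Ha'']].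
  destruct (analytic_derive _ Ab') as [b'' [Ab'' Hb'']].
  exists (Mlog a' b'). intros s Hs. repeat split.
  - exists (a' s). split; [now apply Ha' | now apply euler_alpha].
  - exists (b' s). split; [now apply Hb' | now apply euler_beta].
  - exists (Mlog' a' b' a'' b'' s). split; [now apply is_derive_Mlog | now apply euler_Mlog].
Qed.

(** * The hypergeometric equation in the nome *)

(* [Aw] is F_2(0,q), [Zm] is z_2, [Bw / Aw^2] is 1 - 2 x_2 and [Ym] is the
   positive root of z_2 / q; all are regular at q = 0. *)
Definition Aw (q : R) : R := 2 * alpha q ^ 2 - beta q ^ 2.
Definition Bw (q : R) : R := beta q ^ 4 + 4 * alpha q ^ 2 * beta q ^ 2 - 4 * alpha q ^ 4.
Definition Zm (q : R) : R :=
  16 * alpha q ^ 2 * (alpha q ^ 2 - beta q ^ 2) * beta q ^ 4 / Aw q ^ 4.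
Definition Ym (q : R) : R := 16 * beta q ^ 2 * psi q ^ 4 / Aw q ^ 2.

Lemma Aw_0 : Aw 0 = 1.
Proof. unfold Aw. rewrite alpha_0, beta_0. ring. Qed.

Lemma Zm_0 : Zm 0 = 0.
Proof. unfold Zm. rewrite Aw_0, alpha_0, beta_0. field. Qed.

Lemma Ym_0 : Ym 0 = 16.
Proof. unfold Ym. rewrite Aw_0, beta_0, psi_0. field. Qed.

(** This is 1 - 4x(1 - x) = (1 - 2x)^2. The leading coefficient of the hypergeometric equation thus
    becomes a perfect square. *)
Lemma one_minus_Zm (q : R) : Aw q <> 0 -> 1 - Zm q = Bw q ^ 2 / Aw q ^ 4.
Proof. intros H. unfold Zm, Bw, Aw in *. field. exact H. Qed.

Lemma Zm_Ym (q : R) : Rabs q < 1 -> Aw q <> 0 -> Zm q = q * Ym q ^ 2.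
Proof.
  intros Hq H. unfold Zm, Ym.
  transitivity (4 * beta q ^ 4 * (64 * q * psi q ^ 8) / Aw q ^ 4).
  - rewrite psi_pow8 by exact Hq. field. exact H.
  - field. exact H.
Qed.

Lemma Ym_pos (q : R) : Rabs q < 1 -> Aw q <> 0 -> 0 < Ym q.
Proof.
  intros Hq H. unfold Ym. apply Rdiv_lt_0_compat.
  - apply Rmult_lt_0_compat; [apply Rmult_lt_0_compat; [lra |] |];
      apply pow_lt; [now apply beta_pos | now apply psi_pos].
  - apply pow2_gt_0. exact H.
Qed.

(** The origin of [Aw]: the eta quotient is beta^4 / (q psi^8), and by [psi_pow8] adding 64 gives
    the numerator beta^4 + 4 alpha^2 (alpha^2 - beta^2), the square of 2 alpha^2 - beta^2. *)
Lemma eta_quot_theta (q : R) :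
  Rabs q < 1 -> q <> 0 -> 64 + eta_quot q = Aw q ^ 2 / (q * psi q ^ 8).
Proof.
  intros Hq Hq0.
  assert (HP := psi_pos q Hq).
  replace (Aw q ^ 2) with (beta q ^ 4 + 4 * alpha q ^ 2 * (alpha q ^ 2 - beta q ^ 2))
    by (unfold Aw; ring).
  rewrite <- psi_pow8 by exact Hq.
  transitivity (64 + beta q ^ 4 / (q * psi q ^ 8)).
  - f_equal. unfold eta_quot, beta, phim, psi.
    assert (H1 := qprod_pos q Hq). assert (H2 := qprod_pos _ (Rabs_sqr_lt_1 q Hq)).
    field. repeat split; lra.
  - field. lra.
Qed.

Lemma eta_prod_theta (q : R) :
  Rabs q < 1 -> qprod q ^ 4 * qprod (q ^ 2) ^ 4 = beta q ^ 2 * psi q ^ 4.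
Proof.
  intros Hq. unfold beta, phim, psi.
  assert (H1 := qprod_pos q Hq). assert (H2 := qprod_pos _ (Rabs_sqr_lt_1 q Hq)).
  field. split; lra.
Qed.

Lemma Aw_ne_0 (q : R) : Rabs q < 1 -> q <> 0 -> 64 + eta_quot q <> 0 -> Aw q <> 0.
Proof.
  intros Hq Hq0 H HA. apply H. rewrite eta_quot_theta, HA by assumption.
  unfold Rdiv. rewrite pow_i by lia. ring.
Qed.

Lemma x2_theta (q : R) :
  Rabs q < 1 -> q <> 0 -> Aw q <> 0 ->
  64 / (64 + eta_quot q) = 4 * alpha q ^ 2 * (alpha q ^ 2 - beta q ^ 2) / Aw q ^ 2.
Proof.
  intros Hq Hq0 HA. rewrite <- psi_pow8, eta_quot_theta by assumption.
  assert (HP := psi_pos q Hq). field. repeat split; lra.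
Qed.

Lemma z2_theta (q : R) : Rabs q < 1 -> q <> 0 -> Aw q <> 0 -> z2 q = Zm q.
Proof.
  intros Hq Hq0 HA. unfold z2, x2. rewrite x2_theta by assumption.
  unfold Zm, Aw in *. field. exact HA.
Qed.

Lemma eta_factor_theta (q : R) :
  Rabs q < 1 -> q <> 0 -> Aw q <> 0 -> 1 - 128 / (64 + eta_quot q) = Bw q / Aw q ^ 2.
Proof.
  intros Hq Hq0 HA.
  replace (128 / (64 + eta_quot q)) with (2 * (64 / (64 + eta_quot q))) by (unfold Rdiv; ring).
  rewrite x2_theta by assumption. unfold Bw, Aw in *. field. exact HA.
Qed.

(* Multiplying the n-th coefficient by [n + x] is the Euler operator shifted by [x]. *)
Lemma shifted_coef (x : R) (a : nat -> R) (n : nat) :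
  (INR n + x) * a n = PS_plus (PS_incr_1 (PS_derive a)) (PS_scal x a) n.
Proof.
  unfold PS_plus, PS_incr_1, PS_scal, PS_derive. destruct n as [|n].
  - simpl. unfold plus, scal, zero, mult; simpl. unfold mult; simpl. ring.
  - change ((INR (S n) + x) * a (S n) = INR (S n) * a (S n) + x * a (S n)). ring.
Qed.

Lemma CV_radius_shifted (x r : R) (a : nat -> R) :
  Rbar_le r (CV_radius a) -> Rbar_le r (CV_radius (fun n => (INR n + x) * a n)).
Proof.
  intros Hr. rewrite (CV_radius_ext _ _ (shifted_coef x a)).
  apply CV_radius_ge. intros y Hy.
  assert (Hy' : Rabs y < r) by (rewrite Rabs_pos_eq; lra).
  apply ex_pseries_plus.
  - apply CV_radius_inside. rewrite CV_radius_incr_1, CV_radius_derive.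
    now apply (Rbar_lt_le_1 y r).
  - apply ex_pseries_scal; [apply Rmult_comm |].
    now apply CV_radius_inside, (Rbar_lt_le_1 y r).
Qed.

Lemma is_euler_PSeries (x r : R) (a : nat -> R) (z : R) :
  Rabs z < r -> Rbar_le r (CV_radius a) ->
  is_euler (PSeries a) z (PSeries (fun n => (INR n + x) * a n) z - x * PSeries a z).
Proof.
  intros Hz Hr. assert (Hz' := Rbar_lt_le_1 z r _ Hz Hr).
  exists (PSeries (PS_derive a) z). split; [now apply is_derive_PSeries |].
  rewrite (PSeries_ext _ _ z (shifted_coef x a)), PSeries_plus, PSeries_incr_1, PSeries_scal.
  - ring.
  - apply CV_radius_inside. now rewrite CV_radius_incr_1, CV_radius_derive.
  - apply ex_pseries_scal; [apply Rmult_comm |]. now apply CV_radius_inside.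
Qed.

(** * The hypergeometric series and its differential equation *)

Lemma rising_pos (a : R) (n : nat) : 0 < a -> 0 < rising a n.
Proof.
  intros Ha. induction n as [|n IH]; simpl; [lra |].
  apply Rmult_lt_0_compat; [exact IH |]. generalize (pos_INR n). lra.
Qed.

Lemma hcoef_S (x : R) (n : nat) :
  0 <= x ->
  (INR (S n) + x) ^ 3 * hcoef x (S n)
  = (1 / 2 + (INR n + x)) * (1 / 4 + (INR n + x)) * (3 / 4 + (INR n + x)) * hcoef x n.
Proof.
  intros Hx. unfold hcoef. simpl rising. rewrite S_INR.
  assert (H := rising_pos (1 + x) n ltac:(lra)). assert (H' := pos_INR n).
  field. split; lra.
Qed.

Lemma hcoef_bound (x : R) (n : nat) : 0 <= x -> 0 < hcoef x n <= 1.
Proof.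
  intros Hx. induction n as [|n IH].
  - unfold hcoef. simpl. lra.
  - assert (E := hcoef_S x n Hx). assert (H' := pos_INR n). rewrite S_INR in E.
    set (v := INR n + x) in *.
    replace (INR n + 1 + x) with (1 + v) in E by (unfold v; ring).
    assert (Hv : 0 <= v) by (unfold v; lra).
    assert (H3 : 0 < (1 + v) ^ 3) by (apply pow_lt; lra).
    assert (H0 : 0 < (1 / 2 + v) * (1 / 4 + v) * (3 / 4 + v))
      by (apply Rmult_lt_0_compat; [apply Rmult_lt_0_compat |]; lra).
    assert (H1 : (1 / 2 + v) * (1 / 4 + v) * (3 / 4 + v) <= (1 + v) ^ 3) by nra.
    split.
    + apply (Rmult_lt_reg_l ((1 + v) ^ 3)); [exact H3 |].
      rewrite E, Rmult_0_r. apply Rmult_lt_0_compat; lra.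
    + apply (Rmult_le_reg_l ((1 + v) ^ 3)); [exact H3 |]. rewrite E.
      apply Rle_trans with ((1 / 2 + v) * (1 / 4 + v) * (3 / 4 + v) * 1);
        [apply Rmult_le_compat_l; lra | lra].
Qed.

(** The i-th Euler derivative of the sum of [hcoef x n] z^(n+x), divided by z^x. Without that power
    the function is real and regular at z = 0 for either sign of z; the price is the term - x
    [Kser x i] in its Euler derivative. *)
Definition Kser (x : R) (i : nat) : R -> R := PSeries (fun n => (INR n + x) ^ i * hcoef x n).

Lemma CV_radius_Kser (x : R) (i : nat) :
  0 <= x -> Rbar_le 1 (CV_radius (fun n => (INR n + x) ^ i * hcoef x n)).
Proof.
  intros Hx. induction i as [|i IH].
  - apply (CV_radius_linear _ 1). intros n. rewrite S_INR.
    assert (H := hcoef_bound x n Hx). assert (H' := pos_INR n).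
    simpl. rewrite Rmult_1_l, Rabs_pos_eq; lra.
  - rewrite (CV_radius_ext _ (fun n => (INR n + x) * ((INR n + x) ^ i * hcoef x n)))
      by (intros n; simpl; ring).
    now apply CV_radius_shifted.
Qed.

Lemma is_euler_Kser (x : R) (i : nat) (z : R) :
  0 <= x -> Rabs z < 1 -> is_euler (Kser x i) z (Kser x (S i) z - x * Kser x i z).
Proof.
  intros Hx Hz. unfold Kser at 2.
  rewrite (PSeries_ext _ (fun n => (INR n + x) * ((INR n + x) ^ i * hcoef x n)))
    by (intros n; simpl; ring).
  apply (is_euler_PSeries x 1); [exact Hz | now apply CV_radius_Kser].
Qed.

(** The recurrence [hcoef_S] summed over n. The constants 3/2, 11/16 and 3/32 are the elementary
    symmetric functions of 1/2, 1/4 and 3/4; x^3 is the term n = 0, which the recurrence does not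
    reach. *)
Lemma Kser_ode (x z : R) :
  0 <= x -> Rabs z < 1 ->
  (1 - z) * Kser x 3 z
  = x ^ 3 + z * (3 / 2 * Kser x 2 z + 11 / 16 * Kser x 1 z + 3 / 32 * Kser x 0 z).
Proof.
  intros Hx Hz.
  assert (Hex : forall i, ex_pseries (fun n => (INR n + x) ^ i * hcoef x n) z)
    by (intros i; now apply CV_radius_inside, (Rbar_lt_le_1 z 1), CV_radius_Kser).
  assert (Hsc : forall c i, ex_pseries (PS_scal c (fun n => (INR n + x) ^ i * hcoef x n)) z)
    by (intros c i; apply ex_pseries_scal; [apply Rmult_comm | apply Hex]).
  assert (E : Kser x 3 z = x ^ 3 + z *
     (Kser x 3 z + 3 / 2 * Kser x 2 z + 11 / 16 * Kser x 1 z + 3 / 32 * Kser x 0 z)).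
  { unfold Kser at 1. rewrite PSeries_decr_1 by apply Hex. f_equal.
    - unfold hcoef. simpl. field.
    - f_equal. pose (a := fun i n => (INR n + x) ^ i * hcoef x n).
      change (PSeries (PS_decr_1 (a 3%nat)) z = PSeries (a 3%nat) z + 3 / 2 * PSeries (a 2%nat) z
        + 11 / 16 * PSeries (a 1%nat) z + 3 / 32 * PSeries (a 0%nat) z).
      assert (Hs : forall u v : nat -> R, ex_pseries u z -> ex_pseries v z ->
        ex_pseries (PS_plus u v) z) by (intros; now apply ex_pseries_plus).
      rewrite <- (PSeries_scal (3 / 2)), <- (PSeries_scal (11 / 16)), <- (PSeries_scal (3 / 32)).
      rewrite <- (PSeries_plus (a 3%nat)); [| apply Hex | apply Hsc].
      rewrite <- (PSeries_plus (PS_plus (a 3%nat) _)); [| apply Hs; [apply Hex | apply Hsc] | apply Hsc].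
      rewrite <- (PSeries_plus (PS_plus (PS_plus (a 3%nat) _) _));
        [| apply Hs; [apply Hs; [apply Hex | apply Hsc] | apply Hsc] | apply Hsc].
      apply PSeries_ext. intros n. unfold PS_decr_1, a. rewrite hcoef_S by exact Hx.
      unfold PS_plus, PS_scal.
      change ((1 / 2 + (INR n + x)) * (1 / 4 + (INR n + x)) * (3 / 4 + (INR n + x)) * hcoef x n
        = (INR n + x) ^ 3 * hcoef x n + 3 / 2 * ((INR n + x) ^ 2 * hcoef x n)
          + 11 / 16 * ((INR n + x) ^ 1 * hcoef x n) + 3 / 32 * ((INR n + x) ^ 0 * hcoef x n)).
      field. }
  lra.
Qed.

(** * The hypergeometric operator as the cube of an Euler operator *)

Section Chain.
Variable M : R -> R.
Hypothesis HM : forall s, Rabs s < 1 ->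
    is_euler alpha s (alpha s * (M s + Dlog s) / 2) /\
    is_euler beta s (beta s * (M s - Dlog s) / 2) /\
    is_euler M s ((M s ^ 2 - Dlog s ^ 2) / 2).

(** Hypotheses are tried first, so a function whose Euler derivative is in the context acts as an
    atom. Denominators are discharged by [assumption]; hence the explicit facts such as
    [Aw s ^ 4 <> 0] and even [2 <> 0] before each call. *)
Ltac euler_step :=
  match goal with
  | H : is_euler ?f ?s _ |- is_euler ?f ?s _ => exact H
  | H : is_euler ?f ?s _ |- is_euler (fun t => ?f t) ?s _ => exact H
  | |- is_euler (fun _ => ?c) ?s _ => exact (is_euler_const c s)
  | |- is_euler (fun t => @?f t + @?g t) ?s _ => eapply (is_euler_plus f g s)
  | |- is_euler (fun t => @?f t - @?g t) ?s _ => eapply (is_euler_minus f g s)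
  | |- is_euler (fun t => @?f t / @?g t) ?s _ => eapply (is_euler_div f g s); [ | | assumption ]
  | |- is_euler (fun t => @?f t * @?g t) ?s _ => eapply (is_euler_mult f g s)
  | |- is_euler (fun t => @?f t ^ ?n) ?s _ => eapply (is_euler_pow f n s)
  end.

Ltac euler := eapply is_euler_eq; [ repeat euler_step | ].

Definition Aw1 (s : R) : R := Aw s * M s + Dlog s * (2 * alpha s ^ 2 + beta s ^ 2).

Lemma is_euler_Aw (s : R) : Rabs s < 1 -> is_euler Aw s (Aw1 s).
Proof.
  intros Hs. destruct (HM s Hs) as (Ha & Hb & Hm). unfold Aw at 1. euler.
  unfold Aw1, Aw, Dlog. simpl. field.
Qed.

Lemma is_euler_Bw (s : R) :
  Rabs s < 1 ->
  is_euler Bw s (2 * Bw s * M s + Dlog s * (- 2 * beta s ^ 4 - 8 * alpha s ^ 4)).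
Proof.
  intros Hs. destruct (HM s Hs) as (Ha & Hb & Hm). unfold Bw at 1. euler.
  unfold Bw, Dlog. simpl. field.
Qed.

(** The classical q dz/dq = z sqrt(1 - z) F, with [Bw / Aw ^ 2] as the square root and [Aw] in the
    role of F. *)
Lemma is_euler_Zm (s : R) :
  Rabs s < 1 -> Aw s <> 0 -> is_euler Zm s (Zm s * Bw s / Aw s).
Proof.
  intros Hs HA. destruct (HM s Hs) as (Ha & Hb & Hm). assert (HAw := is_euler_Aw s Hs).
  unfold Zm at 1.
  assert (HA4 : Aw s ^ 4 <> 0) by now apply pow_nonzero.
  euler. unfold Zm, Bw, Aw1, Dlog. simpl. unfold Aw in *. field. exact HA.
Qed.

Lemma M_0 : M 0 = 0.
Proof.
  destruct (HM 0 Rabs_0_lt_1) as (_ & _ & [d [_ E]]).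
  unfold Dlog in E. rewrite alpha_0, beta_0 in E. nra.
Qed.

(** Logarithmic differentiation of [psi_pow8]; the - 1 is the contribution of the factor q there. At
    0 both sides vanish. *)
Lemma is_euler_psi (s : R) :
  Rabs s < 1 -> is_euler psi s (psi s * (2 * M s + alpha s ^ 2 - 1) / 8).
Proof.
  intros Hs. destruct (analytic_derive _ analytic_psi) as [p' [_ Hp]].
  exists (p' s). split; [now apply Hp |].
  destruct (Req_dec s 0) as [-> | Hs0].
  { rewrite M_0, alpha_0. field. }
  destruct (HM s Hs) as (Ha & Hb & Hm).
  assert (Hpe : is_euler psi s (s * p' s)) by (exists (p' s); auto).
  assert (Hid : is_euler (fun t => t) s s) by (exists 1; split; [apply (is_derive_id s) | ring]).
  assert (E1 : is_euler (fun t => 64 * t * psi t ^ 8) s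
     (64 * s * psi s ^ 8 + 512 * s * psi s ^ 7 * (s * p' s))) by (euler; simpl; ring).
  assert (E2 : is_euler (fun t => 64 * t * psi t ^ 8) s
     ((64 * s * psi s ^ 8) * (2 * M s + alpha s ^ 2))).
  { apply (is_euler_ext (fun t => 4 * alpha t ^ 2 * (alpha t ^ 2 - beta t ^ 2))).
    - generalize (locally_disk s Hs). apply filter_imp. intros t Ht. symmetry. now apply psi_pow8.
    - euler. rewrite psi_pow8 by exact Hs. unfold Dlog. simpl. field. }
  assert (E := is_euler_unique _ _ _ _ E1 E2).
  assert (HP := psi_pos s Hs).
  assert (H7 : 512 * s * psi s ^ 7 <> 0).
  { apply Rmult_integral_contrapositive_currified; [lra | apply pow_nonzero; lra]. }
  apply (Rmult_eq_reg_l (512 * s * psi s ^ 7)); [| exact H7].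
  replace (psi s ^ 8) with (psi s * psi s ^ 7) in E by ring. lra.
Qed.

Lemma is_euler_Ym (s : R) :
  Rabs s < 1 -> Aw s <> 0 -> is_euler Ym s (1 / 2 * (Bw s / Aw s - 1) * Ym s).
Proof.
  intros Hs HA. destruct (HM s Hs) as (Ha & Hb & Hm). assert (HAw := is_euler_Aw s Hs).
  assert (Hp := is_euler_psi s Hs).
  unfold Ym at 1. assert (HA2 : Aw s ^ 2 <> 0) by now apply pow_nonzero.
  euler. unfold Ym, Bw, Aw1, Dlog. simpl. unfold Aw in *. field. exact HA.
Qed.

Definition Nm (s : R) : R := alpha s ^ 2 * (alpha s ^ 2 - beta s ^ 2) * beta s ^ 4.

(** For a form A of weight two, 2 A theta^2 A - 3 (theta A)^2 is proportional to a Rankin-Cohen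
    bracket, hence of weight eight; here it equals 3 [Nm]. Thus M and [Dlog] drop out of the second
    derivative. *)
Lemma is_euler_Aw1 (s : R) :
  Rabs s < 1 -> Aw s <> 0 -> is_euler Aw1 s ((3 * Aw1 s ^ 2 + 3 * Nm s) / (2 * Aw s)).
Proof.
  intros Hs HA. destruct (HM s Hs) as (Ha & Hb & Hm). assert (HAw := is_euler_Aw s Hs).
  unfold Aw1 at 1, Dlog at 1. assert (H2 : 2 <> 0) by lra. euler.
  unfold Aw1, Nm, Dlog. simpl. unfold Aw in *. field. exact HA.
Qed.

Lemma is_euler_Nm (s : R) :
  Rabs s < 1 -> is_euler Nm s (Nm s * (4 * M s - Dlog s + (alpha s ^ 2 + beta s ^ 2) / 2)).
Proof.
  intros Hs. destruct (HM s Hs) as (Ha & Hb & Hm).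
  unfold Nm at 1. euler. unfold Nm, Dlog. simpl. field.
Qed.

(** [Y] stands for (z_2/q)^x and is characterized by the Euler equation of that power. The instances
    are the constant 1 for x = 0 and [Ym] for x = 1/2. *)
Variables (x : R) (Y : R -> R).
Hypothesis Hx : 0 <= x.
Hypothesis HY : forall s, Rabs s < 1 -> Aw s <> 0 -> is_euler Y s (x * (Bw s / Aw s - 1) * Y s).

(** This is F_2(x,q) / A without the factor q^x; [Phi1] and [Phi2] arise from it by applying theta +
    x once and twice. Unlike F_2(1/2,q), they are differentiable at q = 0, where the integration
    starts. *)
Definition Phi0 (s : R) : R := Y s * Kser x 0 (Zm s) / Aw s.
Definition Phi1 (s : R) : R :=
  Y s * (Bw s * Kser x 1 (Zm s) - Aw1 s * Kser x 0 (Zm s)) / Aw s ^ 2.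
Definition Phi2 (s : R) : R :=
  Y s * (Bw s ^ 2 * Kser x 2 (Zm s) - (8 * Nm s + Aw1 s * Bw s) * Kser x 1 (Zm s)
         - (3 * Nm s - Aw1 s ^ 2) / 2 * Kser x 0 (Zm s)) / Aw s ^ 3.

Lemma is_euler_Kser_Zm (i : nat) (s : R) :
  Rabs s < 1 -> Aw s <> 0 -> Rabs (Zm s) < 1 ->
  is_euler (fun t => Kser x i (Zm t)) s
    (Bw s / Aw s * (Kser x (S i) (Zm s) - x * Kser x i (Zm s))).
Proof.
  intros Hs HA HZ. destruct (is_euler_Kser x i (Zm s) Hx HZ) as [d [Hd E]].
  rewrite <- E. eapply is_euler_eq.
  - exact (is_euler_comp (Kser x i) Zm s d _ Hd (is_euler_Zm s Hs HA)).
  - field. exact HA.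
Qed.

(* [(q d/dq + x)^3 Phi0 = x^3 Y B]: the hypergeometric operator becomes the
   cube of the Euler operator after division by the weight two form [Aw]. *)
Lemma Phi_chain (s : R) :
  Rabs s < 1 -> Aw s <> 0 -> Rabs (Zm s) < 1 ->
  is_euler Phi0 s (Phi1 s - x * Phi0 s) /\
  is_euler Phi1 s (Phi2 s - x * Phi1 s) /\
  is_euler Phi2 s (x ^ 3 * Y s * Bw s - x * Phi2 s).
Proof.
  intros Hs HA HZ.
  assert (HAw := is_euler_Aw s Hs). assert (HBw := is_euler_Bw s Hs).
  assert (HA1 := is_euler_Aw1 s Hs HA). assert (HN := is_euler_Nm s Hs).
  assert (Hy := HY s Hs HA).
  assert (HK0 := is_euler_Kser_Zm 0 s Hs HA HZ).
  assert (HK1 := is_euler_Kser_Zm 1 s Hs HA HZ).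
  assert (HK2 := is_euler_Kser_Zm 2 s Hs HA HZ).
  assert (HA2 : Aw s ^ 2 <> 0) by now apply pow_nonzero.
  assert (HA3 : Aw s ^ 3 <> 0) by now apply pow_nonzero.
  assert (H20 : 2 <> 0) by lra.
  (* A zero of [Bw] would force z_2 = 1. Hence [Kser_ode] can be solved for the third derivative. *)
  assert (HB : Bw s <> 0).
  { intros E. assert (E1 := one_minus_Zm s HA). rewrite E in E1.
    unfold Rdiv in E1. rewrite pow_i, Rmult_0_l in E1 by lia.
    generalize (Rle_abs (Zm s)). lra. }
  assert (HK3 : Kser x 3 (Zm s) = Aw s ^ 4 / Bw s ^ 2 * (x ^ 3 + 16 * Nm s / Aw s ^ 4 *
    (3 / 2 * Kser x 2 (Zm s) + 11 / 16 * Kser x 1 (Zm s) + 3 / 32 * Kser x 0 (Zm s)))).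
  { replace (16 * Nm s / Aw s ^ 4) with (Zm s) by (unfold Zm, Nm; field; exact HA).
    rewrite <- Kser_ode by assumption. rewrite one_minus_Zm by exact HA.
    field. split; assumption. }
  repeat split.
  - unfold Phi0 at 1. euler. unfold Phi1, Phi0. simpl. field. exact HA.
  - unfold Phi1 at 1. euler. unfold Phi2, Phi1. simpl.
    generalize (Kser x 0 (Zm s)) (Kser x 1 (Zm s)) (Kser x 2 (Zm s)). intros k0 k1 k2.
    unfold Nm, Aw1, Bw, Dlog. unfold Aw in *. field. exact HA.
  - unfold Phi2 at 1. euler. rewrite HK3. unfold Phi2. simpl. clear HK3.
    generalize (Kser x 0 (Zm s)) (Kser x 1 (Zm s)) (Kser x 2 (Zm s)). intros k0 k1 k2.
    unfold Nm, Aw1, Dlog. unfold Bw, Aw in *. field. split; assumption.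
Qed.

End Chain.

(** * Integration along the segment from 0 to q *)

Lemma is_euler_0 (f : R -> R) (e : R) : is_euler f 0 e -> e = 0.
Proof. intros [d [_ <-]]. ring. Qed.

(* [f^2] is non-increasing away from the origin. *)
Lemma euler_eq_zero (x q : R) (f : R -> R) :
  0 <= x -> (forall t, 0 <= t <= 1 -> is_euler f (t * q) (- x * f (t * q))) -> f 0 = 0 ->
  forall t, 0 <= t <= 1 -> f (t * q) = 0.
Proof.
  intros Hx Hf H0 t Ht.
  assert (HD : forall s, 0 <= s <= 1 -> is_derive f (s * q) (Derive f (s * q)) /\
    (s * q) * Derive f (s * q) = - x * f (s * q)).
  { intros s Hs. destruct (Hf s Hs) as [d [Hd E]].
    rewrite (is_derive_unique _ _ _ Hd). now split. }
  assert (Hu : forall s, 0 <= s <= 1 ->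
    is_derive (fun s => f (s * q) ^ 2) s (2 * f (s * q) * Derive f (s * q) * q)).
  { intros s Hs. destruct (HD s Hs) as [Hd _].
    assert (Hl : is_derive (fun s => s * q) s q) by (auto_derive; [exact I | ring]).
    assert (Hc := is_derive_pow _ 2 _ _ (is_derive_comp f (fun s => s * q) s _ _ Hd Hl)).
    replace (2 * f (s * q) * Derive f (s * q) * q)
      with (INR 2 * (q * Derive f (s * q)) * f (s * q) ^ pred 2) by (simpl; ring).
    exact Hc. }
  destruct (MVT_gen (fun s => f (s * q) ^ 2) 0 t
    (fun s => 2 * f (s * q) * Derive f (s * q) * q)) as [c [Hc E]].
  - intros s Hs. apply Hu. rewrite Rmin_left, Rmax_right in Hs by lra. lra.
  - intros s Hs. rewrite Rmin_left, Rmax_right in Hs by lra.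
    apply (is_derive_continuity_pt _ _ _ (Hu s ltac:(lra))).
  - rewrite Rmin_left, Rmax_right in Hc by lra.
    rewrite Rmult_0_l, H0 in E.
    assert (Hneg : 2 * f (c * q) * Derive f (c * q) * q <= 0).
    { destruct (Req_dec c 0) as [-> | Hc0].
      - rewrite Rmult_0_l, H0. lra.
      - assert (Hcp : 0 < c) by lra.
        destruct (HD c ltac:(lra)) as [_ HE].
        (* The Euler equation controls c q f'(c q), not f' itself, hence the multiplication by c >
           0. *)
        apply (Rmult_le_reg_l c); [exact Hcp |].
        replace (c * (2 * f (c * q) * Derive f (c * q) * q))
          with (2 * f (c * q) * (c * q * Derive f (c * q))) by ring.
        rewrite HE. replace (2 * f (c * q) * (- x * f (c * q))) with (- 2 * x * f (c * q) ^ 2) by ring.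
        generalize (pow2_ge_0 (f (c * q))). nra. }
    assert (Hle : f (t * q) ^ 2 <= 0) by nra.
    destruct (Req_dec (f (t * q)) 0) as [Ez | Ez]; [exact Ez |].
    generalize (pow2_gt_0 _ Ez). lra.
Qed.

(** Euler derivatives vanish at 0, so the first two equations evaluated there pass the zero initial
    value from [f0] to [f1] and [f2]. Vanishing along the segment then descends from [f2] to
    [f0]. *)
Lemma euler_chain_eq_zero (x q : R) (f0 f1 f2 : R -> R) :
  0 <= x ->
  (forall t, 0 <= t <= 1 ->
     is_euler f0 (t * q) (f1 (t * q) - x * f0 (t * q)) /\
     is_euler f1 (t * q) (f2 (t * q) - x * f1 (t * q)) /\
     is_euler f2 (t * q) (- x * f2 (t * q))) ->
  f0 0 = 0 ->
  forall t, 0 <= t <= 1 -> f0 (t * q) = 0 /\ f1 (t * q) = 0.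
Proof.
  intros Hx H H0.
  destruct (H 0 ltac:(lra)) as (E0 & E1 & _). rewrite Rmult_0_l in E0, E1.
  apply is_euler_0 in E0. apply is_euler_0 in E1. rewrite H0 in E0.
  assert (F1 : f1 0 = 0) by lra. rewrite F1 in E1.
  assert (Z2 : forall t, 0 <= t <= 1 -> f2 (t * q) = 0).
  { apply (euler_eq_zero x); [exact Hx | intros t Ht; apply (H t Ht) | lra]. }
  assert (Z1 : forall t, 0 <= t <= 1 -> f1 (t * q) = 0).
  { apply (euler_eq_zero x); [exact Hx | | lra]. intros t Ht.
    destruct (H t Ht) as (_ & E & _). rewrite Z2 in E by exact Ht.
    apply (is_euler_eq _ _ _ _ E). ring. }
  intros t Ht. split; [| now apply Z1].
  revert t Ht. apply (euler_eq_zero x); [exact Hx | | exact H0]. intros t Ht.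
  destruct (H t Ht) as (E & _ & _). rewrite Z1 in E by exact Ht.
  apply (is_euler_eq _ _ _ _ E). ring.
Qed.

Definition good_nome (s : R) : Prop := Rabs s < 1 /\ Aw s <> 0 /\ Rabs (Zm s) < 1.

(** The theta form of the size condition extends to t = 0, where the eta quotient itself has a pole;
    integration can start there. *)
Lemma small_nome_good (c : nat -> R) (q : R) :
  q <> 0 -> small_nome c q -> forall t, 0 <= t <= 1 -> good_nome (t * q).
Proof.
  intros Hq0 (Hq & Hseg & _) t Ht.
  assert (Htq : Rabs (t * q) < 1).
  { rewrite Rabs_mult, (Rabs_pos_eq t) by lra. generalize (Rabs_pos q). nra. }
  split; [exact Htq |].
  destruct (Req_dec t 0) as [-> | Ht0].
  { rewrite Rmult_0_l, Aw_0, Zm_0, Rabs_R0. split; lra. }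
  assert (Htq0 : t * q <> 0) by now apply Rmult_integral_contrapositive_currified.
  destruct (Hseg t ltac:(lra)) as [H1 H2].
  assert (HA := Aw_ne_0 _ Htq Htq0 H1). split; [exact HA |].
  now rewrite <- z2_theta.
Qed.

Lemma Kser_0_0 (x : R) : Kser x 0 0 = 1.
Proof. unfold Kser. rewrite PSeries_0. unfold hcoef. simpl. field. Qed.

(** The chain for x = 0 applied to [Phi0 - 1]. The vanishing of [Phi1] is recorded together with
    [M]: it expresses theta [Aw] through [Kser 0 1], the form in which it enters a_2. *)
Lemma hypergeometric_weight_two (q : R) :
  (forall t, 0 <= t <= 1 -> good_nome (t * q)) ->
  Kser 0 0 (Zm q) = Aw q /\
  exists M : R -> R, (forall s, Rabs s < 1 ->
    is_euler alpha s (alpha s * (M s + Dlog s) / 2) /\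
    is_euler beta s (beta s * (M s - Dlog s) / 2) /\
    is_euler M s ((M s ^ 2 - Dlog s ^ 2) / 2)) /\
  Aw1 M q = Bw q * Kser 0 1 (Zm q) / Aw q.
Proof.
  intros Hg. destruct theta_ode as [M HM].
  assert (HY : forall s, Rabs s < 1 -> Aw s <> 0 ->
    is_euler (fun _ => 1) s (0 * (Bw s / Aw s - 1) * 1)).
  { intros s _ _. apply (is_euler_eq _ _ _ _ (is_euler_const 1 s)). ring. }
  assert (HC := fun s => Phi_chain M HM 0 (fun _ => 1) (Rle_refl 0) HY s).
  destruct (euler_chain_eq_zero 0 q (fun s => Phi0 0 (fun _ => 1) s - 1)
    (Phi1 M 0 (fun _ => 1)) (Phi2 M 0 (fun _ => 1)) (Rle_refl 0)) with (t := 1) as [E0 E1].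
  - intros t Ht. destruct (Hg t Ht) as (H1 & H2 & H3).
    destruct (HC _ H1 H2 H3) as (C0 & C1 & C2). repeat split.
    + apply (is_euler_eq _ _ _ _ (is_euler_minus _ _ _ _ _ C0 (is_euler_const 1 _))). ring.
    + exact C1.
    + apply (is_euler_eq _ _ _ _ C2). ring.
  - unfold Phi0. rewrite Zm_0, Kser_0_0, Aw_0. field.
  - lra.
  - rewrite Rmult_1_l in E0, E1.
    destruct (Hg 1 ltac:(lra)) as (_ & HA & _). rewrite Rmult_1_l in HA.
    assert (EK : Kser 0 0 (Zm q) = Aw q).
    { unfold Phi0 in E0. apply Rminus_diag_uniq in E0.
      apply (Rmult_eq_reg_r (/ Aw q)); [| now apply Rinv_neq_0_compat].
      rewrite Rinv_r by exact HA. unfold Rdiv in E0. lra. }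
    split; [exact EK |]. exists M. split; [exact HM |].
    unfold Phi1 in E1. rewrite EK in E1.
    replace (Aw1 M q) with (Bw q * Kser 0 1 (Zm q) / Aw q
      - 1 * (Bw q * Kser 0 1 (Zm q) - Aw1 M q * Aw q) / Aw q ^ 2 * Aw q) by (field; exact HA).
    rewrite E1. ring.
Qed.

(* The n-th coefficient of [(q d/dq + 1/2)^i] applied to [16 sum_n c_n q^n / (2n+1)^2]. *)
Definition iter_coef (g : nat -> R) (i n : nat) : R :=
  (INR n + 1 / 2) ^ i * (16 * coef_f g n / (2 * INR n + 1) ^ 2).

Lemma odd_pos (n : nat) : 0 < 2 * INR n + 1.
Proof. generalize (pos_INR n). lra. Qed.

Lemma CV_radius_iter_coef (g : nat -> R) (r : R) (i : nat) :
  Rbar_le r (CV_radius (coef_f g)) -> Rbar_le r (CV_radius (iter_coef g i)).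
Proof.
  intros Hr. induction i as [|i IH].
  - apply (CV_radius_le_compat _ (coef_f g) 16); [| exact Hr].
    intros n. unfold iter_coef. assert (H := odd_pos n). assert (H' := pos_INR n).
    replace ((INR n + 1 / 2) ^ 0 * (16 * coef_f g n / (2 * INR n + 1) ^ 2))
      with (16 * / (2 * INR n + 1) ^ 2 * coef_f g n) by (field; lra).
    rewrite Rabs_mult. apply Rmult_le_compat_r; [apply Rabs_pos |].
    assert (H2 : 1 <= (2 * INR n + 1) ^ 2) by nra.
    assert (H3 : 0 < / (2 * INR n + 1) ^ 2) by (apply Rinv_0_lt_compat; lra).
    assert (H4 : / (2 * INR n + 1) ^ 2 <= 1)
      by (rewrite <- Rinv_1; apply Rinv_le_contravar; lra).
    rewrite Rabs_pos_eq; lra.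
  - rewrite (CV_radius_ext _ (fun n => (INR n + 1 / 2) * iter_coef g i n))
      by (intros n; unfold iter_coef; simpl; ring).
    now apply CV_radius_shifted.
Qed.

Lemma CV_radius_of_coef_f (g : nat -> R) (r : R) :
  Rbar_le r (CV_radius (coef_f g)) -> Rbar_le r (CV_radius g).
Proof.
  intros Hr.
  apply (CV_radius_le_compat _ (fun n => (INR n + 1 / 2) * coef_f g n) 2);
    [| now apply CV_radius_shifted].
  intros n. unfold coef_f. assert (H := odd_pos n).
  rewrite <- (Rabs_pos_eq 2) at 1 by lra. rewrite <- Rabs_mult. right. f_equal. field. lra.
Qed.

Lemma is_euler_iter_coef (g : nat -> R) (r s : R) (i : nat) :
  Rabs s < r -> Rbar_le r (CV_radius (coef_f g)) ->
  is_euler (PSeries (iter_coef g i)) s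
    (PSeries (iter_coef g (S i)) s - 1 / 2 * PSeries (iter_coef g i) s).
Proof.
  intros Hs Hr.
  rewrite (PSeries_ext (iter_coef g (S i)) (fun n => (INR n + 1 / 2) * iter_coef g i n))
    by (intros n; unfold iter_coef; simpl; ring).
  apply (is_euler_PSeries (1 / 2) r); [exact Hs | now apply CV_radius_iter_coef].
Qed.

(** * The eta expansion along the segment and the case x = 1/2 *)

Lemma Csqrt_ne_0 (q : R) : q <> 0 -> Csqrt q <> RtoC 0.
Proof.
  intros Hq E. unfold Csqrt in E. destruct (Rlt_dec q 0) as [H | H].
  - assert (H' := sqrt_lt_R0 (Rabs q) (Rabs_pos_lt q Hq)).
    apply (f_equal Im) in E. simpl in E. lra.
  - assert (H' := sqrt_lt_R0 q ltac:(lra)). apply RtoC_inj in E. lra.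
Qed.

Lemma analytic_Aw : analytic Aw.
Proof.
  apply analytic_minus; [apply analytic_mult; [apply analytic_const |] |];
    apply analytic_pow; auto using analytic_alpha, analytic_beta.
Qed.

Lemma analytic_Bw : analytic Bw.
Proof.
  assert (Ha := fun n => analytic_pow _ n analytic_alpha).
  assert (Hb := fun n => analytic_pow _ n analytic_beta).
  assert (Hc := fun c f => analytic_mult (fun _ => c) f (analytic_const c)).
  apply (analytic_minus (fun q => beta q ^ 4 + 4 * alpha q ^ 2 * beta q ^ 2)
           (fun q => 4 * alpha q ^ 4)); [| now apply Hc].
  apply analytic_plus; [apply Hb |]. apply analytic_mult; [now apply Hc | apply Hb].
Qed.

Lemma continuity_ne_0_loc (f : R -> R) (x : R) :
  continuity_pt f x -> f x <> 0 -> locally x (fun y => f y <> 0).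
Proof.
  intros Hc H0. assert (He := Rabs_pos_lt _ H0).
  generalize (proj1 (continuity_pt_locally f x) Hc (mkposreal _ He)).
  apply filter_imp. intros y Hy E. simpl in Hy. rewrite E, Rminus_0_l, Rabs_Ropp in Hy. lra.
Qed.

(** The defining identity of g holds near 0, while the integration needs it up to q. With the
    denominator [Aw ^ 2] cleared, comparison of power series coefficients carries it over. *)
Lemma g_expansion_theta (g : nat -> R) :
  g_expansion g -> Rbar_lt 0 (CV_radius g) ->
  forall s, Rabs s < 1 -> Rbar_lt (Rabs s) (CV_radius g) ->
  PSeries g s * Aw s ^ 2 = beta s ^ 2 * psi s ^ 4 * Bw s.
Proof.
  intros Hg Hr.
  apply (PSeries_mult_identity g (fun s => Aw s ^ 2) (fun s => beta s ^ 2 * psi s ^ 4 * Bw s));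
    [apply analytic_pow, analytic_Aw | | exact Hr |].
  { apply analytic_mult; [| apply analytic_Bw].
    apply analytic_mult; apply analytic_pow; auto using analytic_beta, analytic_psi. }
  assert (HA : locally 0 (fun y => Aw y <> 0)).
  { apply continuity_ne_0_loc; [| rewrite Aw_0; lra].
    apply analytic_continuity_pt; [apply analytic_Aw | apply Rabs_0_lt_1]. }
  unfold g_expansion, locally', within in *.
  generalize (filter_and _ _ (filter_and _ _ Hg HA) (locally_disk 0 Rabs_0_lt_1)).
  apply filter_imp. intros q [[Hgq HAq] Hq] Hq0. destruct (Hgq Hq0) as [_ E].
  unfold eta_prod in E.
  rewrite eta_prod_theta, eta_factor_theta, <- Cmult_assoc, <- RtoC_mult in E by assumption.
  assert (E' : RtoC (beta q ^ 2 * psi q ^ 4 * (Bw q / Aw q ^ 2)) = RtoC (PSeries g q)).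
  { rewrite <- (Cmult_1_l (RtoC (PSeries g q))), <- (Cinv_l (Csqrt q)) by now apply Csqrt_ne_0.
    rewrite <- Cmult_assoc, <- E, Cmult_assoc, Cinv_l by now apply Csqrt_ne_0.
    now rewrite Cmult_1_l. }
  apply RtoC_inj in E'. rewrite <- E'. field. exact HAq.
Qed.

(** Both [Phi0] and the series with coefficients [iter_coef g 0] are integrated three times from the
    same function, with the same value at 0. The second conclusion is the equality one derivative
    later, as G_2 requires it. *)
Lemma hypergeometric_half (g : nat -> R) (q : R) :
  g_expansion g -> q <> 0 -> small_nome (coef_f g) q ->
  Ym q * Kser (1 / 2) 0 (Zm q) = Aw q * PSeries (iter_coef g 0) q /\
  Ym q * (Bw q * Kser (1 / 2) 1 (Zm q) - Bw q * Kser 0 1 (Zm q) / Aw q * Kser (1 / 2) 0 (Zm q))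
    / Aw q ^ 2 = PSeries (iter_coef g 1) q.
Proof.
  intros Hg Hq0 Hsmall.
  assert (Hgood := small_nome_good _ q Hq0 Hsmall).
  destruct Hsmall as (Hq & _ & Hrad).
  destruct (hypergeometric_weight_two q Hgood) as (_ & M & HM & HA1).
  assert (Hr : exists r : R, Rabs q < r /\ Rbar_le r (CV_radius (coef_f g))).
  { destruct (CV_radius (coef_f g)) as [c | |]; simpl in Hrad; try easy.
    - exists c. simpl. split; lra.
    - exists (Rabs q + 1). simpl. split; [lra | easy]. }
  destruct Hr as (r & Hqr & Hr).
  assert (Hrg := CV_radius_of_coef_f g r Hr).
  assert (Hy : forall s, Rabs s < 1 -> Aw s <> 0 -> is_euler Ym s (1 / 2 * (Bw s / Aw s - 1) * Ym s))
    by exact (is_euler_Ym M HM).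
  assert (Hh : 0 <= 1 / 2) by lra.
  assert (HC := Phi_chain M HM (1 / 2) Ym Hh Hy).
  destruct (euler_chain_eq_zero (1 / 2) q
    (fun s => Phi0 (1 / 2) Ym s - PSeries (iter_coef g 0) s)
    (fun s => Phi1 M (1 / 2) Ym s - PSeries (iter_coef g 1) s)
    (fun s => Phi2 M (1 / 2) Ym s - PSeries (iter_coef g 2) s) Hh) with (t := 1) as [E0 E1].
  - intros t Ht. destruct (Hgood t Ht) as (H1 & H2 & H3).
    assert (Htr : Rabs (t * q) < r).
    { rewrite Rabs_mult, (Rabs_pos_eq t) by lra. generalize (Rabs_pos q). nra. }
    destruct (HC _ H1 H2 H3) as (C0 & C1 & C2).
    assert (I0 := is_euler_iter_coef g r (t * q) 0 Htr Hr).
    assert (I1 := is_euler_iter_coef g r (t * q) 1 Htr Hr).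
    assert (I2 := is_euler_iter_coef g r (t * q) 2 Htr Hr).
    repeat split.
    + apply (is_euler_eq _ _ _ _ (is_euler_minus _ _ _ _ _ C0 I0)). ring.
    + apply (is_euler_eq _ _ _ _ (is_euler_minus _ _ _ _ _ C1 I1)). ring.
    + apply (is_euler_eq _ _ _ _ (is_euler_minus _ _ _ _ _ C2 I2)).
      (* Here (n + 1/2)^3 * 16 / (2n+1)^3 = 2; on the other side x^3 = 1/8 meets the 16 in [Ym]. *)
      rewrite (PSeries_ext (iter_coef g 3) (PS_scal 2 g)), PSeries_scal.
      2:{ intros n. unfold iter_coef, coef_f, PS_scal.
          change (scal 2 (g n)) with (2 * g n). assert (H := odd_pos n). field. lra. }
      assert (EG : PSeries g (t * q) * Aw (t * q) ^ 2
                   = beta (t * q) ^ 2 * psi (t * q) ^ 4 * Bw (t * q)).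
      { apply g_expansion_theta; [exact Hg | | exact H1 | now apply (Rbar_lt_le_1 _ r)].
        apply (Rbar_lt_le_trans 0 r); [simpl; generalize (Rabs_pos q); lra | exact Hrg]. }
      replace (PSeries g (t * q)) with (PSeries g (t * q) * Aw (t * q) ^ 2 / Aw (t * q) ^ 2)
        by (field; exact H2).
      rewrite EG. unfold Ym at 1. field. exact H2.
  (* Both functions equal 16 at 0: [Ym 0] is 16, and g_0 = 1 is read off from the expansion. *)
  - destruct (Hgood 0 ltac:(lra)) as (H1 & H2 & H3). rewrite Rmult_0_l in *.
    assert (E0 := is_euler_0 _ _ (proj1 (HC _ H1 H2 H3))).
    unfold Phi0. rewrite Zm_0, Kser_0_0, Aw_0, Ym_0, PSeries_0. unfold iter_coef, coef_f.
    simpl.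
    assert (G0 : PSeries g 0 * Aw 0 ^ 2 = beta 0 ^ 2 * psi 0 ^ 4 * Bw 0).
    { assert (Hg0 : Rbar_lt 0 (CV_radius g)).
      { apply (Rbar_lt_le_trans 0 r); [simpl; generalize (Rabs_pos q); lra | exact Hrg]. }
      apply g_expansion_theta; [exact Hg | exact Hg0 | exact H1 | now rewrite Rabs_R0]. }
    rewrite PSeries_0, Aw_0, beta_0, psi_0 in G0. unfold Bw in G0.
    rewrite alpha_0, beta_0 in G0. replace (g 0%nat) with 1 by lra. field.
  - lra.
  - rewrite Rmult_1_l in E0, E1.
    destruct (Hgood 1 ltac:(lra)) as (_ & HA & _). rewrite Rmult_1_l in HA.
    apply Rminus_diag_uniq in E0. apply Rminus_diag_uniq in E1. split.
    + rewrite <- E0. unfold Phi0. field. exact HA.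
    + rewrite <- E1. unfold Phi1. rewrite HA1. reflexivity.
Qed.

(** * From complex series to real ones, and the two identities *)

Lemma CSeries_scal (a : nat -> R) (w : C) :
  CSeries (fun n => (RtoC (a n) * w)%C) = (RtoC (Series a) * w)%C.
Proof.
  unfold CSeries. apply injective_projections; simpl.
  - rewrite (Series_ext _ (fun n => a n * Re w)) by (intros n; unfold Re; ring).
    rewrite Series_scal_r. unfold Re. ring.
  - rewrite (Series_ext _ (fun n => a n * Im w)) by (intros n; unfold Im; ring).
    rewrite Series_scal_r. unfold Im. ring.
Qed.

Lemma CSeries_ext (u v : nat -> C) : (forall n, u n = v n) -> CSeries u = CSeries v.
Proof.
  intros E. unfold CSeries. f_equal; apply Series_ext; intros n; now rewrite E.
Qed.

Lemma F2_Kser (x q : R) : F2 x q = (RtoC (Kser x 0 (z2 q)) * Crpow (z2 q) x)%C.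
Proof.
  unfold F2, Kser, PSeries. rewrite <- CSeries_scal. apply CSeries_ext. intros n.
  unfold z2pow. rewrite Cmult_assoc, <- RtoC_mult. simpl. now rewrite Rmult_1_l.
Qed.

Lemma G2_Kser (x q a b : R) :
  0 <= x -> Rabs (z2 q) < 1 -> a2 q = RtoC a -> b2 q = RtoC b ->
  G2 x q = (RtoC (a * Kser x 0 (z2 q) + b * Kser x 1 (z2 q)) * Crpow (z2 q) x)%C.
Proof.
  intros Hx Hz Ea Eb.
  assert (Hex : forall c i,
    ex_series (fun n => c * ((INR n + x) ^ i * hcoef x n * z2 q ^ n))).
  { intros c i. apply (ex_series_scal_l (V := R_NormedModule)), ex_series_Rabs, CV_disk_inside.
    now apply (Rbar_lt_le_1 _ 1), CV_radius_Kser. }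
  unfold G2. rewrite Ea, Eb. unfold Kser, PSeries.
  rewrite <- !Series_scal_l, <- Series_plus, <- CSeries_scal by apply Hex.
  apply CSeries_ext. intros n. unfold z2pow.
  rewrite Cmult_assoc, <- !RtoC_mult, <- RtoC_plus, <- !RtoC_mult.
  do 2 f_equal. simpl. ring.
Qed.

(** A positive square changes neither the sign nor the branch. With z_2 = q [Ym]^2 the square roots
    of z_2 and q therefore carry the same factor i when q < 0. *)
Lemma Csqrt_mul_sqr (q y : R) : 0 < y -> Csqrt (q * y ^ 2) = (Csqrt q * RtoC y)%C.
Proof.
  intros Hy. assert (Hy2 : 0 < y ^ 2) by now apply pow_lt.
  unfold Csqrt. destruct (Rlt_dec q 0) as [H | H]; destruct (Rlt_dec (q * y ^ 2) 0) as [H' | H'].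
  - rewrite Rabs_mult, (Rabs_pos_eq (y ^ 2)) by lra.
    rewrite sqrt_mult, sqrt_pow2, RtoC_mult by (try apply Rabs_pos; lra).
    now rewrite Cmult_assoc.
  - exfalso. nra.
  - exfalso. nra.
  - rewrite sqrt_mult, sqrt_pow2, RtoC_mult by lra. reflexivity.
Qed.

(** A neighbourhood is needed because a_2 and b_2 contain derivatives of z_2 and F_2(0,q). *)
Lemma z2_theta_loc (q : R) :
  Rabs q < 1 -> q <> 0 -> Aw q <> 0 -> locally q (fun s => z2 s = Zm s /\ z2 s <> 0).
Proof.
  intros Hq Hq0 HA.
  assert (L1 := locally_disk q Hq).
  assert (L2 := continuity_ne_0_loc Aw q (analytic_continuity_pt _ _ analytic_Aw Hq) HA).
  assert (L3 := continuity_ne_0_loc (fun s => s) q (derivable_continuous_pt _ _ (derivable_pt_id q)) Hq0).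
  generalize (filter_and _ _ (filter_and _ _ L1 L2) L3). apply filter_imp.
  intros s [[H1 H2] H3]. assert (E := z2_theta s H1 H3 H2). split; [exact E |].
  rewrite E, Zm_Ym by assumption.
  apply Rmult_integral_contrapositive_currified; [exact H3 |].
  apply pow_nonzero. assert (H := Ym_pos s H1 H2). lra.
Qed.

Theorem theorem5 :
  forall (g : nat -> R), g_expansion g ->
  forall (q : R), q <> 0 -> small_nome (coef_f g) q ->
    F2 (1 / 2) q
    = (16 * F2 0 q * Csqrt q
       * RtoC (Series (fun n => (coef_f g n * (q ^ n / (2 * INR n + 1) ^ 2))%R)))%C
    /\
    G2 (1 / 2) q
    = (16 * Csqrt q / PI
       * (RtoC (Series (fun n => (coef_f g n * (q ^ n / (2 * INR n + 1) ^ 2))%R))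
          - ln (Rabs q) / 2
            * RtoC (Series (fun n => (coef_f g n * (q ^ n / (2 * INR n + 1)))%R))))%C.
Proof.
  intros g Hg q Hq0 Hsmall.
  assert (Hgood := small_nome_good _ q Hq0 Hsmall).
  destruct (hypergeometric_half g q Hg Hq0 Hsmall) as [E0 E1].
  destruct (hypergeometric_weight_two q Hgood) as (EA & M & HM & _).
  destruct (Hgood 1 ltac:(lra)) as (Hq & HA & HZ). rewrite Rmult_1_l in Hq, HA, HZ.
  assert (HY := Ym_pos q Hq HA).
  assert (Hloc := z2_theta_loc q Hq Hq0 HA).
  destruct (locally_singleton _ _ Hloc) as [Ez Ez0].
  assert (Hpi := PI_RGT_0).
  set (S0 := Series (fun n => coef_f g n * (q ^ n / (2 * INR n + 1) ^ 2))) in *.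
  set (S1 := Series (fun n => coef_f g n * (q ^ n / (2 * INR n + 1)))) in *.
  assert (ES0 : PSeries (iter_coef g 0) q = 16 * S0).
  { unfold PSeries, S0. rewrite <- Series_scal_l. apply Series_ext. intros n.
    unfold iter_coef. assert (H := odd_pos n). field. lra. }
  assert (ES1 : PSeries (iter_coef g 1) q = 8 * S1).
  { unfold PSeries, S1. rewrite <- Series_scal_l. apply Series_ext. intros n.
    unfold iter_coef. assert (H := odd_pos n). field. lra. }
  rewrite ES0 in E0. rewrite ES1 in E1.
  assert (EF0 : F2 0 q = RtoC (Aw q)).
  { rewrite F2_Kser, Crpow_0, Ez, EA by exact Ez0. apply Cmult_1_r. }
  assert (Esq : Crpow (z2 q) (1 / 2) = (Csqrt q * RtoC (Ym q))%C).
  { rewrite Crpow_half by exact Ez0. rewrite Ez, Zm_Ym by assumption. now apply Csqrt_mul_sqr. }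
  set (L := ln (Rabs q)).
  assert (Eb : b2 q = RtoC (- (L / PI) * (Bw q / Aw q / Aw q))).
  { unfold b2. rewrite EF0, Ez, (Derive_ext_loc z2 Zm)
      by (generalize Hloc; apply filter_imp; now intros s [Hs _]).
    destruct (is_euler_Zm M HM q Hq HA) as [d [Hd Ed]].
    rewrite (is_derive_unique _ _ _ Hd), Ed. fold L.
    rewrite Ez in Ez0.
    rewrite <- RtoC_mult, <- RtoC_div, <- RtoC_opp, <- RtoC_mult
      by now apply Rmult_integral_contrapositive_currified.
    f_equal. field. repeat split; lra. }
  assert (EdF : CDerive (F2 0) q = RtoC (Derive (fun s => Kser 0 0 (Zm s)) q)).
  { assert (HF : locally q (fun s => F2 0 s = RtoC (Kser 0 0 (Zm s)))).
    { generalize Hloc. apply filter_imp. intros s [Hs Hs0].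
      rewrite F2_Kser, Crpow_0, Hs by exact Hs0. apply Cmult_1_r. }
    unfold CDerive, RtoC. f_equal.
    - apply Derive_ext_loc. generalize HF. apply filter_imp. intros s Hs. now rewrite Hs.
    - rewrite (Derive_ext_loc _ (fun _ => 0)); [apply Derive_const |].
      generalize HF. apply filter_imp. intros s Hs. now rewrite Hs. }
  assert (Ea : a2 q = RtoC (1 / (PI * Aw q)
    * (1 + L * (Bw q * Kser 0 1 (Zm q) / Aw q / Aw q)))).
  { unfold a2. rewrite EF0, EdF. fold L.
    destruct (is_euler_Kser_Zm M HM 0 (Rle_refl 0) 0 q Hq HA HZ) as [d [Hd Ed]].
    rewrite (is_derive_unique _ _ _ Hd).
    rewrite <- !RtoC_mult, <- !RtoC_div by (try apply Rmult_integral_contrapositive_currified; lra).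
    rewrite <- !RtoC_mult, <- RtoC_plus, <- RtoC_mult. rewrite Ed. f_equal. field. lra. }
  split.
  - rewrite F2_Kser, Esq, EF0, Ez.
    transitivity (RtoC (Ym q * Kser (1 / 2) 0 (Zm q)) * Csqrt q)%C.
    { rewrite RtoC_mult. ring. }
    rewrite E0, !RtoC_mult. ring.
  - rewrite (G2_Kser (1 / 2) q _ _ ltac:(lra) ltac:(now rewrite Ez) Ea Eb), Esq, Ez.
    (* Up to the factor q^(1/2), the left side is (1/pi)(1 - L theta) applied to F_2(1/2,q) /
       F_2(0,q): the L term of a_2 together with b_2 is the quotient rule. [E0] and [E1] evaluate
       the quotient and its Euler derivative as 16 [S0] and 8 [S1]. *)
    assert (E : (1 / (PI * Aw q) * (1 + L * (Bw q * Kser 0 1 (Zm q) / Aw q / Aw q)) * Kser (1 / 2) 0 (Zm q)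
        + - (L / PI) * (Bw q / Aw q / Aw q) * Kser (1 / 2) 1 (Zm q)) * Ym q
        = 16 / PI * (S0 - L / 2 * S1)).
    { transitivity (/ PI * (Ym q * Kser (1 / 2) 0 (Zm q) / Aw q
        - L * (Ym q * (Bw q * Kser (1 / 2) 1 (Zm q)
                 - Bw q * Kser 0 1 (Zm q) / Aw q * Kser (1 / 2) 0 (Zm q)) / Aw q ^ 2))).
      - field. lra.
      - rewrite E0, E1. field. lra. }
    transitivity (Csqrt q * RtoC (16 / PI * (S0 - L / 2 * S1)))%C.
    { rewrite <- E, RtoC_mult. ring. }
    rewrite RtoC_mult, RtoC_minus, RtoC_mult, !RtoC_div by lra.
    unfold Cdiv. ring.
Qed.
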